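(* Let $K$ be a field of characteristic zero, let $n \ge 1$ and let $R=K[x_1,\dots,x_n]$ be the standard graded polynomial ring. Let $d_0,d_1,\dots,d_{n-1}$ be positive integers and let $a\in K$ with $a\neq 1$. Let $I\subset R$ be the ideal generated by the $n$ polynomials $x_n^{d_0}(x_n-a x_1)$ and $x_i^{d_i}(x_i-x_{i+1})$ for $1\le i\le n-1$. Then $R/I$ is an artinian complete intersection and has the strong Lefschetz property.
   Context: A graded artinian $K$-algebra $A=R/I=\bigoplus_k A_k$ (with $I$ a homogeneous ideal) has the strong Lefschetz property (SLP) if there is a linear form $\ell\in A_1$ such that for all $k$ and all $s$ the multiplication map $\times \ell^s: A_{k-s}\to A_k$ has maximal rank, i.e., is injective or surjective. *)

(* Defs.v *)
From HB Require Import structures.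
From mathcomp Require Import all_boot all_order all_algebra.
From mathcomp Require Import boolp.
From mathcomp Require Import mpoly.

Set Implicit Arguments.
Unset Strict Implicit.
Unset Printing Implicit Defensive.

Import GRing.Theory.

Local Open Scope ring_scope.
Local Open Scope quotient_scope.

Section CommutativeAlgebra.
Variable A : comNzRingType.

Definition is_ideal (J : A -> Prop) : Prop :=
  [/\ J 0, forall x y, J x -> J y -> J (x + y) & forall a x, J x -> J (a * x)].

Definition artinian : Prop :=
  forall J : nat -> A -> Prop,
    (forall i, is_ideal (J i)) ->
    (forall i x, J i.+1 x -> J i x) ->
    exists N, forall i, (N <= i)%N -> forall x, J N x -> J i x.

Definition ideal_gen (fs : seq A) (x : A) : Prop :=
  exists c : 'I_(size fs) -> A, x = \sum_(i < size fs) c i * fs`_i.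

Definition regular_sequence (fs : seq A) : Prop :=
  ~ ideal_gen fs 1 /\
  forall i, (i < size fs)%N -> forall x,
    ideal_gen (take i fs) (fs`_i * x) -> ideal_gen (take i fs) x.

Lemma ideal_gen_ideal (fs : seq A) : is_ideal (ideal_gen fs).
Proof.
split=> [|_ _ [c ->] [e ->]|a _ [c ->]].
- by exists (fun=> 0); rewrite big1 // => i _; rewrite mul0r.
- exists (fun i => c i + e i); rewrite -big_split /=.
  by apply: eq_bigr => i _; rewrite mulrDl.
- exists (fun i => a * c i); rewrite mulr_sumr.
  by apply: eq_bigr => i _; rewrite mulrA.
Qed.

End CommutativeAlgebra.

Section GradedQuotient.
Variables (K : fieldType) (n : nat) (I : idealr {mpoly K[n]}).

Definition complete_intersection : Prop :=
  exists fs : seq {mpoly K[n]},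
    [/\ forall f, f \in fs -> exists k, f \is k.-homog,
        regular_sequence fs
      & forall p, p \in I <-> ideal_gen fs p].

(* The image in the quotient of the forms of degree k.  These images grade the
   quotient when I is homogeneous, which complete_intersection I entails. *)
Definition graded_piece (k : nat) (x : {ideal_quot I}) : Prop :=
  exists2 p : {mpoly K[n]}, p \is k.-homog & x = \pi_{ideal_quot I} p.

Definition mul_injective (u : {ideal_quot I}) (i : nat) : Prop :=
  forall x y, graded_piece i x -> graded_piece i y -> u * x = u * y -> x = y.

Definition mul_surjective (u : {ideal_quot I}) (i j : nat) : Prop :=
  forall z, graded_piece j z -> exists2 x, graded_piece i x & u * x = z.

(* For s > k the source A_(k - s) is zero and the condition is void; the
   hypothesis s <= k avoids the truncated subtraction. *)
Definition strong_lefschetz : Prop :=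
  exists2 l : {ideal_quot I}, graded_piece 1 l &
    forall k s, (s <= k)%N ->
      mul_injective (l ^+ s) (k - s) \/ mul_surjective (l ^+ s) (k - s) k.

End GradedQuotient.

Section TheIdeal.
Variables (K : fieldType) (n : nat) (d : 'I_n.+1 -> nat) (a : K).

(* The variables x_1, ..., x_(n+1) are 'X_0, ..., 'X_n, so that for i < n the
   generator with leading variable 'X_i carries the exponent d_(i+1), and ordS
   is the successor. *)
Definition cyc_generator (i : 'I_n.+1) : {mpoly K[n.+1]} :=
  if i == ord_max then 'X_ord_max ^+ d ord0 * ('X_ord_max - a *: 'X_ord0)
  else 'X_i ^+ d (ordS i) * ('X_i - 'X_(ordS i)).

Definition cyc_generators : seq {mpoly K[n.+1]} :=
  [seq cyc_generator i | i <- enum 'I_n.+1].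

Definition cyc_ideal : {pred {mpoly K[n.+1]}} :=
  fun p => `[< ideal_gen cyc_generators p >].

Lemma cyc_ideal_closed : idealr_closed cyc_ideal.
Proof.
have [I0 ID IM] := ideal_gen_ideal cyc_generators.
split=> [||b u v /asboolP Iu /asboolP Iv]; first exact/asboolP.
- apply/asboolP=> -[c /(congr1 (meval (fun=> 0 : K)))].
  rewrite meval1 raddf_sum /= big1 => [/eqP|i _]; first by rewrite oner_eq0.
  rewrite mevalM; set f := cyc_generators`_i.
  have /mapP[j _ ->] : f \in cyc_generators by apply: mem_nth.
  rewrite /cyc_generator; case: ifP => _.
    by rewrite mevalM mevalB mevalZ !mevalXU mulr0 subrr !mulr0.
  by rewrite mevalM mevalB !mevalXU subrr !mulr0.
- by apply/asboolP/ID => //; apply: IM.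
Qed.

HB.instance Definition _ := isIdealr.Build _ cyc_ideal cyc_ideal_closed.

End TheIdeal.

(* Main.v *)
(* Put e_i for the exponent of x_i in the i-th generator x_i^{e_i} (x_i - c x_{i+1}),
   where c = 1, except that c = a for the last generator, and x_{n+1} = x_1.

   Modulo the ideal the excess over e_i moves from x_i to x_{i+1}.  Modulo all
   generators but the last one this is a terminating rewriting system, and the
   quotient is free over K[x_n]; there x_n - a x_1 is injective since a <> 1.
   Hence the generators form a regular sequence and the monomials x^u with u <= e
   form a basis of the quotient A.  In this basis x_i x^u is x^{u + 1_q}, up to a
   factor a when the end is passed, q being the first position from i on,
   cyclically, with u_q < e_q, and it vanishes when there is none.

   Give a suitable height to the basis elements and to the variables.
   Multiplication by l_t = sum_i t^{-height(x_i)} x_i, in the basis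
   t^{-height(u)} x^u, is then polynomial in t, and its value at t = 0 is the
   multiplication by the sum of the variables on a direct sum of monomial complete
   intersections K[y]/(y_i^{b_i + 1}), all shifted so as to be symmetric about
   |e| / 2.  (These summands are the successive strings of x_1: they play the role
   of the central simple modules of (A, x_1).)  The strong Lefschetz property of
   the summands follows from sl_2 theory in characteristic zero, and it passes to
   l_t for all but finitely many t, because it says that certain determinants,
   polynomial in t, do not vanish. *)

Require Import Defs.
From HB Require Import structures.
From mathcomp Require Import all_boot all_order all_algebra.
From mathcomp Require Import boolp.
From mathcomp Require Import mpoly.
From mathcomp Require Import ssrcomplements zify ring.

Set Implicit Arguments.
Unset Strict Implicit.
Unset Printing Implicit Defensive.

Import GRing.Theory.

Local Open Scope quotient_scope.
Local Open Scope ring_scope.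

(** * Monomial complete intersections *)

Lemma pchar0_natr_neq0 (K : fieldType) (m : nat) :
  [pchar K] =i pred0 -> (0 < m)%N -> m%:R != 0 :> K.
Proof. by move=> /pcharf0P -> ; rewrite -lt0n. Qed.

Lemma mcoeffXUM (R : comNzRingType) n (i : 'I_n) (p : {mpoly R[n]}) m :
  ('X_i * p)@_m = if (0 < m i)%N then p@_(m - U_(i)) else 0.
Proof.
case: ifP => mi.
  have Em : (U_(i) + (m - U_(i)))%MM = m by rewrite addmC submK // lep1mP -lt0n.
  by rewrite -[in LHS]Em mulrC mcoeffMX.
rewrite [p]mpolyE mulr_sumr raddf_sum big1 //= => k _.
rewrite -scalerAr mcoeffZ -mpolyXD mcoeffX.
case: eqP => [E|]; last by rewrite mulr0.
by move: mi; rewrite -E mnmDE mnm1E eqxx.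
Qed.

Lemma mpoly_euler (R : comNzRingType) n j (p : {mpoly R[n]}) :
  p \is j.-homog -> \sum_i 'X_i * p^`M(i) = j%:R *: p.
Proof.
move=> pj; rewrite [in RHS](mpolyE p) scaler_sumr.
have dp i : 'X_i * p^`M(i) = \sum_(m <- msupp p) ((m i)%:R * p@_m) *: 'X_[m].
  rewrite [in LHS](mpolyE p) raddf_sum mulr_sumr; apply: eq_bigr => m _ /=.
  rewrite linearZ /= mderivX -!scalerAr scalerA mulrC.
  have [->|mi] := eqVneq (m i) 0%N; first by rewrite mul0r !scale0r.
  by rewrite -mpolyXD addmC submK // lep1mP.
under eq_bigr do rewrite dp.
rewrite exchange_big /=; apply: eq_big_seq => m mp.
rewrite -scaler_suml -mulr_suml -natr_sum -mdegE.
by rewrite (dhomog_mf pj mp) scalerA.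
Qed.

Section BoxLefschetz.
Variables (K : fieldType) (charK0 : [pchar K] =i pred0) (n : nat).
Implicit Types (p q : {mpoly K[n]}) (b m : 'X_{1..n}).

Definition var_sum : {mpoly K[n]} := \sum_i 'X_i.

(* Membership in the monomial ideal generated by the 'X_i ^+ (b i).+1. *)
Definition trunc_zero b p := forall m, (m <= b)%MM -> p@_m = 0.

(* With multiplication by var_sum this generates an action of sl2 on the whole
   polynomial ring which preserves the ideal trunc_zero b. *)
Definition lowering b p :=
  \sum_i ((b i)%:R *: p^`M(i) - 'X_i * p^`M(i)^`M(i)).

Lemma trunc_zeroB b p q :
  trunc_zero b p -> trunc_zero b q -> trunc_zero b (p - q).
Proof. by move=> pb qb m mb; rewrite mcoeffB pb // qb // subr0. Qed.

Lemma trunc_zeroZ b c p : trunc_zero b p -> trunc_zero b (c *: p).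
Proof. by move=> pb m mb; rewrite mcoeffZ pb // mulr0. Qed.

Lemma trunc_zero_var_sum b p : trunc_zero b p -> trunc_zero b (var_sum * p).
Proof.
move=> pb m mb; rewrite mulr_suml raddf_sum big1 //= => i _.
rewrite mcoeffXUM; case: ifP => // _; apply: pb.
exact: lepm_trans (lem_subr _ _) mb.
Qed.

(** Only at exponents with [m i = b i] does a coefficient from outside the box come in. There the
    two terms of [lowering] multiply it by [b i * (m i).+1] and [m i * (m i).+1], and cancel. *)
Lemma trunc_zero_lowering b p : trunc_zero b p -> trunc_zero b (lowering b p).
Proof.
move=> pb m mb; rewrite raddf_sum big1 //= => i _.
rewrite mcoeffB mcoeffZ mcoeffXUM mcoeff_mderiv.
have [mi|] := ltnP (m i) (b i).
  have mUb : (m + U_(i) <= b)%MM.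
    apply/mnm_lepP => k; rewrite mnmDE mnm1E.
    by have [<-|_] := eqVneq; [rewrite addn1 | rewrite addn0; apply/mnm_lepP].
  case: ifP => mi0; last by rewrite pb // mul0rn mulr0 subr0.
  rewrite !mcoeff_mderiv submK ?lep1mP -?lt0n // pb //.
  by rewrite !mul0rn mulr0 subr0.
have /mnm_lepP/(_ i) mbi := mb => bmi.
have {bmi mbi}bmi : b i = m i by apply/eqP; rewrite eqn_leq bmi.
rewrite bmi; case: ifP => mi0; last first.
  by move/negbT: mi0; rewrite lt0n negbK => /eqP ->; rewrite mul0r subr0.
rewrite !mcoeff_mderiv submK ?lep1mP -?lt0n // mnmBE mnm1E eqxx.
by rewrite subn1 prednK // -[X in _ - X]mulr_natl subrr.
Qed.

(** The sl2 relation: the commutator is the sum over i of b_i - 2 x_i d/dx_i, which Euler's identity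
    evaluates to the weight [mdeg b - 2 * j] on forms of degree j. *)
Lemma lowering_var_sum b j p : p \is j.-homog ->
  lowering b (var_sum * p) =
    var_sum * lowering b p + ((mdeg b)%:R - (2 * j)%:R) *: p.
Proof.
move=> pj; have dX i : var_sum^`M(i) = 1.
  rewrite raddf_sum (bigD1 i) //= big1 ?addr0 => [|k ki].
    rewrite mderivX mnm1E eqxx scale1r.
    suff -> : (U_(i) - U_(i) = 0)%MM by rewrite mpolyX0.
    by apply/mnmP => l; rewrite mnmBE mnm0E subnn.
  by rewrite mderivX mnm1E (negbTE ki) scale0r.
rewrite /lowering mulr_sumr scalerBl mdegE natr_sum scaler_suml.
rewrite natrM -scalerA -(mpoly_euler pj) scaler_sumr -sumrB -big_split /=.
apply: eq_bigr => i _.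
rewrite mderivM dX mul1r mderivD mderivM dX mul1r -!mul_mpolyC !mpolyC_nat.
ring.
Qed.

Lemma var_sumX_homog s j p : p \is j.-homog -> var_sum ^+ s * p \is (s + j).-homog.
Proof.
have X1 : var_sum \is 1.-homog.
  by apply: rpred_sum => i _; rewrite dhomogX /= mdeg1.
move=> pj; apply: dhomogM => //.
by have := dhomogMn s X1; rewrite mul1n.
Qed.

(** The weights [mdeg b - 2 * (j + r)] met along the string, for r from 0 to s, add up to
    [s.+1 * (mdeg b - 2 * j - s)]. *)
Lemma lowering_var_sumX b j p s : p \is j.-homog ->
  lowering b (var_sum ^+ s.+1 * p) = var_sum ^+ s.+1 * lowering b p
    + (s.+1%:R * ((mdeg b)%:R - (2 * j + s)%:R)) *: (var_sum ^+ s * p).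
Proof.
move=> pj; elim: s => [|s IH].
  by rewrite !expr1 expr0 mul1r (lowering_var_sum _ pj) addn0 mul1r.
rewrite exprS -mulrA (lowering_var_sum _ (var_sumX_homog _ pj)) IH.
rewrite mulrDr -scalerAr !mulrA -!exprS -addrA -scalerDl; congr (_ + _ *: _).
by rewrite !natrD !natrM !natrD; ring.
Qed.

Lemma lowering_homog b j p :
  p \is j.+1.-homog -> lowering b p \is j.-homog.
Proof.
move=> pj; have dp k i q : q \is k.-homog -> q^`M(i) \is k.-1.-homog.
  move=> qk; rewrite [q]mpolyE raddf_sum big_seq rpred_sum //= => m mq.
  rewrite linearZ /= mderivX dhomogZ //.
  have [->|mi] := eqVneq (m i) 0%N; first by rewrite scale0r dhomog0.
  rewrite dhomogZ // dhomogX -(dhomog_mf qk mq) /=.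
  rewrite -[in X in _ == X](@submK _ U_(i) m) ?lep1mP //.
  by rewrite /= mdegD mdeg1 addn1.
rewrite rpred_sum // => i _; rewrite rpredB //; first exact/dhomogZ/(dp j.+1).
case: j pj => [|j] pj; last first.
  by rewrite -[j.+1]add1n dhomogM ?dhomogX /= ?mdeg1 //; apply/(dp j.+1)/(dp j.+2).
suff -> : p^`M(i)^`M(i) = 0 by rewrite mulr0 dhomog0.
have /dhomogP p1 := pj.
apply/mpolyP => m; rewrite !mcoeff_mderiv mcoeff0.
rewrite (dhomog_nemf_coeff pj) ?mul0rn //.
by rewrite /= !mdegD !mdeg1 !addn1.
Qed.

Lemma lowering_homog0 b p : p \is 0.-homog -> lowering b p = 0.
Proof.
move=> p0; have d0 i : p^`M(i) = 0.
  apply/mpolyP => m; rewrite mcoeff_mderiv mcoeff0 (dhomog_nemf_coeff p0) ?mul0rn //.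
  by rewrite /= mdegD mdeg1 addn1.
by rewrite /lowering big1 // => i _; rewrite !d0 mderiv0 mulr0 scaler0 subrr.
Qed.

(* The strong Lefschetz property of K[X]/('X_i ^+ (b i).+1). *)
Lemma box_lefschetz b j p s : p \is j.-homog -> (s + 2 * j <= mdeg b)%N ->
  trunc_zero b (var_sum ^+ s * p) -> trunc_zero b p.
Proof.
(* The commutation relation is solved for [var_sum ^+ t * q]: its constant
   [t.+1 * (mdeg b - 2 * k - t)] is a positive integer, hence invertible in characteristic zero. *)
have step k q t : q \is k.-homog -> (t.+1 + 2 * k <= mdeg b)%N ->
  trunc_zero b (lowering b q) -> trunc_zero b (var_sum ^+ t.+1 * q) ->
  trunc_zero b (var_sum ^+ t * q).
  move=> qk tb Yq Xq; have := lowering_var_sumX b t qk.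
  set c := _%:R * _ => E.
  have c0 : c != 0.
    by rewrite /c -natrB; [rewrite mulf_neq0 // pchar0_natr_neq0 //; lia | lia].
  rewrite -[_ * q](scalerK c0) -(addKr (var_sum ^+ t.+1 * lowering b q) (c *: _)).
  rewrite -E addrC; apply: trunc_zeroZ; apply: trunc_zeroB.
    exact: trunc_zero_lowering.
  by elim: (t.+1) => [|r IHr]; rewrite ?mul1r // exprS -mulrA; apply: trunc_zero_var_sum.
elim: j p s => [|j IHj] p s pj sb.
  elim: s sb => [|s IHs] sb pb; first by rewrite expr0 mul1r in pb.
  apply: IHs; first by apply: leq_trans sb; rewrite leq_add2r.
  by apply: (step 0%N) pb => //; rewrite lowering_homog0 // => m _; rewrite mcoeff0.
elim: s sb => [|s IHs] sb pb; first by rewrite expr0 mul1r in pb.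
apply: IHs; first by apply: leq_trans sb; rewrite leq_add2r.
apply: (step j.+1) => //.
(* The induction on the degree is applied to [lowering b p] with one more power of [var_sum].
   Multiplying the commutation relation by [var_sum] expresses [var_sum ^+ s.+2 * lowering b p] by
   terms already known to vanish on the box. *)
apply: (IHj _ s.+2); [exact: lowering_homog | lia |].
have := lowering_var_sumX b s pj; set c := _%:R * _ => /(congr1 ( *%R var_sum)).
rewrite mulrDr -scalerAr !mulrA -!exprS => /eqP; rewrite -subr_eq => /eqP <-.
apply: trunc_zeroB; last exact: trunc_zeroZ.
exact/trunc_zero_var_sum/trunc_zero_lowering.
Qed.

End BoxLefschetz.

(** * Semicontinuity *)

(** In characteristic zero the first [size P] naturals have distinct images, which are too many to
    be all roots of P. *)
Lemma exists_nonroot (K : fieldType) (charK0 : [pchar K] =i pred0) (P : {poly K}) :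
  P != 0 -> exists t, P.[t] != 0.
Proof.
move=> P0; pose rs : seq K := [seq i%:R | i <- iota 0 (size P)].
have rsU : uniq rs.
  rewrite map_inj_uniq ?iota_uniq // => i j /eqP.
  wlog ij : i j / (i <= j)%N => [th|].
    by have [/th|/ltnW/th h] := leqP i j; first exact; rewrite eq_sym => /h.
  rewrite eq_sym -subr_eq0 -natrB // ((pcharf0P _ ).1 charK0) subn_eq0 => ji.
  by apply/eqP; rewrite eqn_leq ij.
case: (boolP (all (root P) rs)) => [/(max_poly_roots P0)/(_ rsU)|/allPn[t _ Pt]].
  by rewrite size_map size_iota ltnn.
by exists t.
Qed.

Section Semicontinuity.
Variables (N : nat) (deg : 'I_N -> nat) (c : nat) (flip : 'I_N -> 'I_N).
Hypotheses (flipK : involutive flip)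
  (deg_flip : forall i, (deg (flip i) + deg i)%N = c).

Definition in_degree (F : fieldType) j (v : 'rV[F]_N) :=
  forall i, deg i != j -> v 0 i = 0.

(** Vectors are rows acted on from the right, so row i holds the coordinates of the image of basis
    vector i. *)
Definition graded_mx (R : pzRingType) s (M : 'M[R]_N) :=
  forall i k, deg k != (deg i + s)%N -> M i k = 0.

Lemma graded_mxX (R : pzRingType) (M : 'M[R]_N) s :
  graded_mx 1 M -> graded_mx s (M ^+ s).
Proof.
move=> gM; elim: s => [|s IH] i k.
  by rewrite addn0 expr0 mxE; have [->|] := eqVneq i k; rewrite ?eqxx.
rewrite exprSr -mulmxE mxE => ik; apply: big1 => l _.
have [il|/IH ->] := eqVneq (deg l) (deg i + s)%N; last by rewrite mul0r.
by rewrite [M l k]gM ?mulr0 // il addn1 -addnS.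
Qed.

(* Reading the target through flip makes M restricted to degree j a square
   block, which is completed by the identity. *)
Definition square_mx (R : pzRingType) j (M : 'M[R]_N) : 'M[R]_N :=
  \matrix_(i, k) if deg i == j then M i (flip k) else (i == k)%:R.

Section Field.
Variables (F : fieldType) (j : nat) (M : 'M[F]_N).
Hypotheses (jc : (2 * j <= c)%N) (gM : graded_mx (c - 2 * j)%N M).

Lemma square_mxE (v : 'rV[F]_N) k :
  (v *m square_mx j M) 0 k =
    if deg k == j then \sum_(i | deg i == j) v 0 i * M i (flip k) else v 0 k.
Proof.
rewrite mxE (bigID (fun i => deg i == j)) /=.
have -> : \sum_(i | deg i != j) v 0 i * square_mx j M i k =
    if deg k == j then 0 else v 0 k.
  under eq_bigr => i ij do rewrite mxE (negbTE ij).
  case: ifP => kj.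
    rewrite big1 // => i ij; case: eqP => [ik|]; last by rewrite mulr0.
    by rewrite ik kj in ij.
  rewrite (bigD1 k) ?kj //= eqxx mulr1 big1 ?addr0 // => i /andP[_ /negbTE ->].
  by rewrite mulr0.
under eq_bigr => i ij do rewrite mxE ij.
case: ifP => kj; first by rewrite addr0.
rewrite big1 ?add0r // => i /eqP ij; rewrite gM ?mulr0 // ij.
by apply/eqP => h; have := deg_flip k; move/negbT/eqP: kj; lia.
Qed.

Lemma in_degree_mulmx (v : 'rV[F]_N) k : in_degree j v ->
  (v *m M) 0 k = \sum_(i | deg i == j) v 0 i * M i k.
Proof.
move=> vj; rewrite mxE (bigID (fun i => deg i == j)) /= [X in _ + X]big1 ?addr0 //.
by move=> i /vj ->; rewrite mul0r.
Qed.

(** The identity block forces a kernel vector of the completed matrix into degree j, where it is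
    also killed by M. *)
Lemma det_square_mx_neq0 :
  (forall v : 'rV_N, in_degree j v -> v *m M = 0 -> v = 0) ->
  \det (square_mx j M) != 0.
Proof.
move=> inj; apply/det0P => -[v v0 vQ]; case/eqP: v0.
have vQE k := square_mxE v k; rewrite vQ in vQE.
have vj : in_degree j v by move=> k kj; have := vQE k; rewrite (negbTE kj) mxE.
apply: inj => //; apply/rowP => k; rewrite in_degree_mulmx // [RHS]mxE.
have [kj|kj] := eqVneq (deg (flip k)) j.
  by have := vQE (flip k); rewrite kj eqxx flipK mxE => <-.
rewrite big1 // => i /eqP ij; rewrite gM ?mulr0 //.
by apply/eqP => h; have := deg_flip k; move/eqP: kj; lia.
Qed.

Lemma square_mx_bijective : \det (square_mx j M) != 0 ->
  (forall v : 'rV_N, in_degree j v -> v *m M = 0 -> v = 0) /\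
  (forall w : 'rV_N, in_degree (c - j)%N w ->
     exists2 v : 'rV_N, in_degree j v & v *m M = w).
Proof.
move=> Q0; have Qu : square_mx j M \in unitmx by rewrite unitmxE unitfE.
split=> [v vj vM|w wj].
  rewrite -(mulmxK Qu v); suff -> : v *m square_mx j M = 0 by rewrite mul0mx.
  apply/rowP => k; rewrite square_mxE mxE; case: ifP => [_|/negbT/vj //].
  by rewrite -in_degree_mulmx // vM mxE.
pose w' := \row_k w 0 (flip k); pose v := w' *m invmx (square_mx j M).
have vQ : v *m square_mx j M = w' by rewrite mulmxKV.
have vQE k := square_mxE v k; rewrite vQ in vQE.
have vj : in_degree j v.
  move=> k kj; have := vQE k; rewrite (negbTE kj) mxE => <-; apply: wj.
  by apply/eqP => h; have := deg_flip k; move/eqP: kj; lia.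
exists v => //; apply/rowP => k; rewrite in_degree_mulmx //.
have [kj|kj] := eqVneq (deg (flip k)) j.
  by have := vQE (flip k); rewrite kj eqxx mxE flipK => ->.
rewrite big1 => [|i /eqP ij].
  by rewrite wj //; apply/eqP => h; have := deg_flip k; move/eqP: kj; lia.
rewrite gM ?mulr0 //.
by apply/eqP => h; have := deg_flip k; move/eqP: kj; lia.
Qed.

End Field.

Variables (K : fieldType) (charK0 : [pchar K] =i pred0) (L : 'M[{poly K}]_N).
Hypothesis gL : graded_mx 1 L.

(** Bijectivity from degree j to degree c - j is the nonvanishing of a determinant polynomial in t,
    which is nonzero at t = 0 by assumption. Finitely many j occur, so one t avoids the roots of all
    these determinants. *)
Lemma exists_bijective_horner :
  (forall j (v : 'rV_N), (2 * j <= c)%N -> in_degree j v ->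
     v *m map_mx (horner_eval 0) L ^+ (c - 2 * j)%N = 0 -> v = 0) ->
  exists2 t : K, t != 0 & forall j, (2 * j <= c)%N ->
    (forall v : 'rV_N, in_degree j v ->
       v *m map_mx (horner_eval t) L ^+ (c - 2 * j)%N = 0 -> v = 0) /\
    (forall w : 'rV_N, in_degree (c - j)%N w -> exists2 v : 'rV_N,
       in_degree j v & v *m map_mx (horner_eval t) L ^+ (c - 2 * j)%N = w).
Proof.
move=> inj0.
have LX t s : map_mx (horner_eval t) (L ^+ s) = map_mx (horner_eval t) L ^+ s.
  elim: s => [|s IH]; first by rewrite !expr0 map_mx1.
  by rewrite !exprS -!mulmxE map_mxM IH.
have gLt t s : graded_mx s (map_mx (horner_eval t) L ^+ s).
  by apply: graded_mxX => i k ik; rewrite mxE gL // /horner_eval horner0.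
pose D j := \det (square_mx j (L ^+ (c - 2 * j)%N)).
have DE t j : (D j).[t] = \det (square_mx j (map_mx (horner_eval t) L ^+ (c - 2 * j)%N)).
  rewrite -[_.[t]]/(horner_eval t _) -det_map_mx -LX; congr (\det _).
  apply/matrixP => i k; rewrite !mxE; case: ifP => _; rewrite ?mxE //.
  by rewrite rmorph_nat.
(* The factor ['X] makes the chosen t nonzero. *)
pose P := 'X * \prod_(j < c.+1 | (2 * j <= c)%N) D j.
have P0 : P != 0.
  rewrite mulf_neq0 ?polyX_eq0 //; apply/prodf_neq0 => j jc.
  apply/eqP => /(congr1 (fun p => p.[0])); rewrite DE horner0; apply/eqP.
  by apply: det_square_mx_neq0 => // v vj; apply: inj0.
have [t] := exists_nonroot charK0 P0.
rewrite hornerM hornerX mulf_eq0 negb_or horner_prod => /andP[t0 /prodf_neq0 Dt].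
exists t => // j jc; apply: square_mx_bijective => //.
have jc1 : (j < c.+1)%N by lia.
by rewrite -DE (Dt (Ordinal jc1)).
Qed.

End Semicontinuity.

(** * Combinatorics of the monomial basis *)

Section Codes.
Variables (n : nat) (e : 'X_{1..n.+1}).
Implicit Types (u v : 'X_{1..n.+1}) (i j q : 'I_n.+1).
Local Open Scope nat_scope.

(* Write the monomial u, all of whose units fit below e, as a prefix followed by
   the exponents from position brk u on, where brk u is the first nonzero
   exponent after a position that is not full, or n.+1.  The prefix is filled
   greedily from the left, hence determined by its sum, which is the exponent of
   'X_ord0 in code u.  For a fixed value r of brk u the codes fill the box below
   code_bound r.  The bound for 'X_ord0 is psum e r - 1 when r < n.+1, as the
   prefix is then not full, and the exponent at r is lowered by 1, since it is
   positive. *)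
Definition psum u (k : nat) := \sum_(i < n.+1 | i < k) u i.

Definition stops u j := (0 < u j) && (psum u j < psum e j).

Definition brk u := find (stops u) (enum 'I_n.+1).

Definition code u : 'X_{1..n.+1} :=
  [multinom if i < brk u then (if i == ord0 then psum u (brk u) else 0)
            else u i - (i == brk u :> nat) | i < n.+1].

Definition code_bound (r : nat) : 'X_{1..n.+1} :=
  [multinom if i < r then (if i == ord0 then psum e r - (r < n.+1) else 0)
            else e i - (i == r :> nat) | i < n.+1].

(* The term n.+1 - r makes the passage from one box to another strictly
   increasing. *)
Definition height_at (r : nat) u :=
  \sum_(i < n.+1) (if i < r then 2 * n.+1 else i) * u i + (n.+1 - r).

Definition height u := height_at (brk u) u.

(** A unit added to the prefix weighs [2 * n.+1] in [height_at] and, if the break stays, counts as a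
    factor ['X_ord0] in the code; hence the special value at [ord0]. *)
Definition var_height i := if i == ord0 then 2 * n.+1 else i : nat.

Lemma brk_le u : brk u <= n.+1.
Proof. by rewrite /brk -[X in _ <= X](size_enum_ord n.+1) find_size. Qed.

Lemma before_brk u j : j < brk u -> ~~ stops u j.
Proof. by move=> /(before_find ord0); rewrite nth_ord_enum => ->. Qed.

Lemma at_brk u j : j = brk u :> nat -> stops u j.
Proof.
move=> jr; have : has (stops u) (enum 'I_n.+1).
  by rewrite has_find size_enum_ord -/(brk u) -jr.
by move/(nth_find ord0); rewrite -/(brk u) -jr nth_ord_enum.
Qed.

Lemma brk_leP u j : stops u j -> brk u <= j.
Proof. by move=> sj; rewrite leqNgt; apply/negP => /before_brk; rewrite sj. Qed.

Lemma brk_geP u (r : nat) : r <= n.+1 -> (forall j, j < r -> ~~ stops u j) -> r <= brk u.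
Proof.
move=> rn h; rewrite leqNgt; apply/negP => br.
have bn : brk u < n.+1 by lia.
by have /negP := h (Ordinal bn) br; apply; apply: at_brk.
Qed.

Lemma psumS u j : psum u j.+1 = psum u j + u j.
Proof.
rewrite /psum (bigD1 j) //= addnC; congr (_ + _).
apply: eq_bigl => i; rewrite ltnS ltn_neqAle andbC.
by congr (_ && _).
Qed.

Lemma psum0 u : psum u 0 = 0.
Proof. by rewrite /psum big_pred0. Qed.

Lemma psum_mono u (j k : nat) : j <= k -> psum u j <= psum u k.
Proof.
move=> jk; rewrite /psum [X in _ <= X](bigID (fun i : 'I_n.+1 => i < j)) /=.
rewrite (eq_bigl (fun i : 'I_n.+1 => (i < k) && (i < j))) ?leq_addr // => i.
by case: ltnP => ij; rewrite ?andbF // andbT; lia.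
Qed.

Lemma psum_le u (k : nat) : (u <= e)%MM -> psum u k <= psum e k.
Proof. by move=> /mnm_lepP ue; apply: leq_sum. Qed.

Lemma psumD1 u q (k : nat) : psum (u + U_(q))%MM k = psum u k + (q < k).
Proof.
rewrite /psum (eq_bigr (fun i => u i + (q == i))) => [|i _]; last first.
  by rewrite mnmDE mnm1E.
rewrite big_split /=; congr (_ + _); case: ltnP => qk.
  rewrite (bigD1 q) //= eqxx big1 // => i /andP[_ /negbTE].
  by rewrite eq_sym => ->.
by rewrite big1 // => i ik; case: eqP => // qi; rewrite qi in qk; lia.
Qed.

Lemma psum_full u (k : nat) : (forall j, j < k -> u j = e j) -> psum u k = psum e k.
Proof. by move=> h; apply: eq_bigr. Qed.

(** Once the prefix sum falls short of that of [e], it stays short, and any later positive exponent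
    would be a stop. So only zeros occur up to the break. *)
Lemma psum_flat u (j k : nat) :
  psum u j < psum e j -> j <= k <= brk u -> psum u k = psum u j.
Proof.
move=> uj; elim: k => [|k IH] /andP[jk kr].
  by move: jk; rewrite leqn0 => /eqP ->.
have [->//|jk1] := eqVneq j k.+1.
have {}IH := IH ltac:(lia); have kn : k < n.+1 by have := brk_le u; lia.
rewrite (psumS u (Ordinal kn)) /= IH.
have : ~~ stops u (Ordinal kn) by apply: before_brk.
rewrite /stops /= IH; have := @psum_mono e j k ltac:(lia); lia.
Qed.

Lemma zero_before_brk u i : psum u i < psum e i -> i < brk u -> u i = 0.
Proof. by move=> ui /before_brk; rewrite /stops ui andbT; lia. Qed.

(** This is the greedy filling: the prefix is full until its total is used up, and zero
    afterwards. *)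
Lemma psum_packed u (j : nat) : (u <= e)%MM -> j <= brk u ->
  psum u j = minn (psum e j) (psum u (brk u)).
Proof.
move=> ue jr; have := psum_le j ue; rewrite leq_eqVlt => /orP[/eqP E|lt].
  by rewrite -E; apply/esym/minn_idPl/psum_mono.
by rewrite (psum_flat lt) ?jr ?leqnn //; lia.
Qed.

Lemma brk_gt0 u : 0 < brk u.
Proof.
rewrite lt0n; apply/eqP => r0; have := @at_brk u ord0 (esym r0).
by rewrite /stops !psum0 andbF.
Qed.

(** The prefix total determines all prefix sums, hence the exponents before the break. At the break
    the exponent is positive, so lowering it by 1 loses nothing. *)
Lemma code_inj u v : (u <= e)%MM -> (v <= e)%MM ->
  brk u = brk v -> code u = code v -> u = v.
Proof.
move=> ue ve rE /mnmP cE; apply/mnmP => i.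
have [ir|ri] := ltnP i (brk u).
  have := cE ord0; rewrite !mnmE -rE brk_gt0 eqxx => sE.
  have pE k : k <= brk u -> psum u k = psum v k.
    by move=> kr; rewrite (psum_packed ue kr) sE [RHS](psum_packed ve) -?rE.
  by have := psumS u i; have := psumS v i; rewrite !pE ?(ltnW ir) //; lia.
have := cE i; rewrite !mnmE -rE ltnNge ri /=.
case: eqP => [ir|_]; last by rewrite !subn0.
have := at_brk ir; have := at_brk (etrans ir rE).
by rewrite /stops; lia.
Qed.

Section AddOne.
Variables (u : 'X_{1..n.+1}) (q : 'I_n.+1).
Let v := (u + U_(q))%MM.

Lemma height_atD1 (r : nat) :
  height_at r v = height_at r u + (if q < r then 2 * n.+1 else q).
Proof.
rewrite /height_at addnAC; congr (_ + _).
under eq_bigr => i _ do rewrite mnmDE mnm1E mulnDr.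
rewrite big_split /=; congr (_ + _).
rewrite (bigD1 q) //= eqxx muln1 big1 ?addn0 // => i /negbTE.
by rewrite eq_sym => ->; rewrite muln0.
Qed.

Lemma brk_right : brk u <= q -> brk v = brk u /\ code v = (code u + U_(q))%MM.
Proof.
move=> rq; have rE : brk v = brk u.
  apply/eqP; rewrite eqn_leq; apply/andP; split; last first.
    apply: brk_geP => [|j jr]; first exact: brk_le.
    have := before_brk jr; rewrite /stops mnmDE mnm1E psumD1.
    have -> : (q == j) = false by apply/eqP => qj; rewrite qj in rq; lia.
    have -> : (q < j) = false by lia.
    by rewrite !addn0.
  have rn : brk u < n.+1 by apply: leq_ltn_trans (ltn_ord q).
  have := @at_brk u (Ordinal rn) erefl; rewrite /stops => /andP[h1 h2].
  apply: (@brk_leP v (Ordinal rn)); rewrite /stops mnmDE psumD1 /=.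
  by rewrite /= in h2; lia.
split=> //; apply/mnmP => i; rewrite mnmDE !mnmE rE.
have [ir|ri] := ltnP i (brk u).
  have -> : (q == i) = false by apply/eqP => qi; rewrite qi in rq; lia.
  by rewrite psumD1 addn0; case: ifP => // _; lia.
have [ir|_] := eqVneq (nat_of_ord i) (brk u); last by rewrite !subn0.
by have := at_brk ir; rewrite /stops; lia.
Qed.

Lemma height_right : brk u <= q -> height v = height u + q.
Proof.
move=> rq; have [rE _] := brk_right rq.
by rewrite /height rE height_atD1 ltnNge rq.
Qed.

(** A new break appears at q. The positions from q up to the old break hold zeros, so their change
    of weight costs nothing, while the term [n.+1 - r] grows. *)
Lemma height_new : q < brk u -> psum u q < psum e q -> height u + q < height v.
Proof.
move=> qr uq; have rE : brk v = q.
  apply/eqP; rewrite eqn_leq; apply/andP; split.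
    by apply: brk_leP; rewrite /stops mnmDE mnm1E eqxx psumD1 ltnn addn0 uq andbT; lia.
  apply: brk_geP => [|j jq]; first exact/ltnW.
  have := @before_brk u j ltac:(lia); rewrite /stops mnmDE mnm1E psumD1.
  have -> : (q == j) = false by apply/eqP => qj; rewrite qj in jq; lia.
  have -> : (q < j) = false by lia.
  by rewrite !addn0.
rewrite /height rE height_atD1 ltnn ltn_add2r /height_at.
have := brk_le u; suff -> : \sum_(i < n.+1) (if i < q then 2 * n.+1 else i) * u i =
  \sum_(i < n.+1) (if i < brk u then 2 * n.+1 else i) * u i by have := ltn_ord q; lia.
apply: eq_bigr => i _; case: ltnP => iq; case: ltnP => ir //; first by lia.
rewrite [u i]zero_before_brk ?muln0 // (@psum_flat u q i) ?iq ?(ltnW ir) //.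
exact: leq_trans uq (psum_mono _ _).
Qed.

Lemma brk_left : q < brk u -> psum u q = psum e q -> brk u <= brk v.
Proof.
move=> qr uq; apply: brk_geP => [|j jr]; first exact: brk_le.
have := before_brk jr; rewrite /stops mnmDE mnm1E psumD1.
have [<-|_] := eqVneq; first by rewrite uq; lia.
by rewrite addn0 !negb_and => /orP[->//|h]; apply/orP; right; lia.
Qed.

(** The break moves right. The positive exponent at the old break then has its weight raised from
    [brk u] to [2 * n.+1], which exceeds the loss in the term [n.+1 - r]. *)
Lemma height_left : q < brk u -> psum u q = psum e q -> brk v != brk u ->
  height u + 2 * n.+1 < height v.
Proof.
move=> qr uq vr; have := brk_left qr uq; rewrite leq_eqVlt eq_sym (negbTE vr) /= => rv.
have := brk_le v; have rn : brk u < n.+1 by have := brk_le v; lia.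
have := height_atD1 (brk u); rewrite qr /height => <-; rewrite /height_at (bigD1 (Ordinal rn)) //= ltnn.
rewrite [X in _ < X + _](bigD1 (Ordinal rn)) //= rv.
have : \sum_(i < n.+1 | i != Ordinal rn) (if i < brk u then 2 * n.+1 else i) * v i <=
   \sum_(i < n.+1 | i != Ordinal rn) (if i < brk v then 2 * n.+1 else i) * v i.
  apply: leq_sum => i _; rewrite leq_mul2r; apply/orP; right.
  by have := ltn_ord i; case: (ltnP i (brk u)) => ?; case: (ltnP i (brk v)) => ?; lia.
have : 0 < v (Ordinal rn).
  have := @at_brk u (Ordinal rn) erefl; rewrite /stops mnmDE => /andP[h _].
  by lia.
move=> v0; set x := v _ in v0 *.
have rN : brk u <= 2 * n.+1 by lia.
have : 2 * n.+1 - brk u + brk u * x <= 2 * n.+1 * x.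
  by rewrite -[X in _ <= X * x](subnK rN) mulnDl leq_add2r leq_pmulr.
move: (brk u * x) (2 * n.+1 * x) => y z yz.
move: (\sum_(i < _ | _) _) (\sum_(i < _ | _) _) => A B; lia.
Qed.

Lemma height_same : q < brk u -> brk v = brk u -> height v = height u + 2 * n.+1.
Proof. by move=> qr rE; rewrite /height rE height_atD1 qr. Qed.

Lemma code_left : q < brk u -> brk v = brk u -> code v = (code u + U_(ord0))%MM.
Proof.
move=> qr rE; apply/mnmP => i; rewrite mnmDE !mnmE rE psumD1 qr.
have [ir|ri] := ltnP i (brk u); first by rewrite [ord0 == i]eq_sym; case: eqP.
have -> : (q == i) = false by apply/eqP => qi; rewrite qi in qr; lia.
have -> : (ord0 == i) = false.
  by apply/eqP => i0; have := brk_gt0 u; rewrite -i0 in ri; rewrite /= in ri; lia.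
by rewrite !addn0.
Qed.

End AddOne.

(* A unit added at position i moves on past the full positions and settles at q. *)
Definition settles u i q :=
  [/\ i <= q, u q < e q & forall j, i <= j < q -> u j = e j].

(** The unit has passed the last position and starts again from position 0. That the positions from
    i on are full is stated separately where it is used. *)
Definition settles_around u i q :=
  [/\ q < i, u q < e q & forall j, j < q -> u j = e j].

Lemma left_of_brk u q : (u <= e)%MM -> (forall j, j < q -> u j = e j) -> q < brk u.
Proof.
move=> ue h; rewrite ltnNge; apply/negP => rq.
have rn : brk u < n.+1 by apply: leq_ltn_trans (ltn_ord q).
have := @at_brk u (Ordinal rn) erefl; rewrite /stops psum_full ?ltnn ?andbF //=.
by move=> j jr; apply: h; lia.
Qed.

(** The inequality is strict, so the products carrying the factor [a] disappear at t = 0. The unit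
    lands in the prefix and gains at least [2 * n.+1], while i is not [ord0]. *)
Lemma height_settles_around u i q : (u <= e)%MM -> settles_around u i q ->
  height u + var_height i < height (u + U_(q))%MM.
Proof.
move=> ue [qi uq full]; have qr := left_of_brk ue full.
have h : height u + 2 * n.+1 <= height (u + U_(q))%MM.
  have [rE|] := eqVneq (brk (u + U_(q))%MM) (brk u); first by rewrite height_same.
  by move=> /(height_left qr (psum_full full)); lia.
apply: leq_trans h; rewrite ltn_add2l /var_height; case: eqP => [i0|_].
  by rewrite i0 in qi.
by have := ltn_ord i; lia.
Qed.

(* Equality holds exactly when the product stays within the box of u. *)
Lemma height_settles u i q : (u <= e)%MM -> settles u i q ->
  height u + var_height i <= height (u + U_(q))%MM ?= iff
    (brk (u + U_(q))%MM == brk u) && (code (u + U_(q))%MM == (code u + U_(i))%MM).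
Proof.
move=> ue [iq uq full]; have q0 : i = ord0 -> q < brk u /\ psum u q = psum e q.
  move=> i0; have h j : j < q -> u j = e j by move=> jq; apply: full; rewrite i0.
  by split; [exact: left_of_brk | exact: psum_full].
(* Three cases. At or beyond the break the code gains [U_(q)], and equality means q = i. Left of it
   with a prefix full up to q, either the break stays and the code gains [U_(ord0)], or it moves
   right and the height jumps. Otherwise a new break appears at q and the height jumps. *)
have iN := ltn_ord i; rewrite /var_height; have [rq|qr] := leqP (brk u) q.
  have i0 : i != ord0 by apply/eqP => /q0[]; rewrite ltnNge rq.
  have [-> ->] := brk_right rq; rewrite (negbTE i0) eqxx eqm_add2l eq_mnm1.
  rewrite height_right //; split; first by rewrite leq_add2l.
  by rewrite eqn_add2l eq_sym.
have vE := code_left qr; have := psum_le q ue.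
rewrite leq_eqVlt => /orP[/eqP E|lt]; last first.
  have i0 : i != ord0 by apply/eqP => /q0[_ uE]; rewrite uE ltnn in lt.
  have h := height_new qr lt; rewrite (negbTE i0); split; first by lia.
  rewrite ltn_eqF ?(leq_ltn_trans _ h) ?leq_add2l //; apply/esym/negbTE/negP.
  case/andP=> /eqP/vE ->; rewrite eqm_add2l eq_mnm1 eq_sym.
  by rewrite (negbTE i0).
have [rE|rE] := eqVneq (brk (u + U_(q))%MM) (brk u).
  rewrite vE // height_same // eqm_add2l eq_mnm1 [ord0 == i]eq_sym /=.
  by case: eqVneq => i0; split; lia.
have h := height_left qr E rE; case: eqP => _; split; lia.
Qed.

(** Every product that is nonzero in the box algebra comes from a settling unit. At or beyond the
    break the unit stays at i; before it the bound only allows i = [ord0], and the unit goes to the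
    first position that is not full. *)
Lemma settles_code u i : (u <= e)%MM ->
  (code u + U_(i) <= code_bound (brk u))%MM -> exists q,
  [/\ settles u i q, brk (u + U_(q))%MM = brk u &
      code (u + U_(q))%MM = (code u + U_(i))%MM].
Proof.
move=> ue /mnm_lepP/(_ i); rewrite mnmDE !mnmE eqxx addn1.
have [ir|ri] := ltnP i (brk u); last first.
  move=> h; have [rE cE] := brk_right ri; exists i; split=> //; split=> //.
    have [ir|nir] := eqVneq (nat_of_ord i) (brk u); last by lia.
    by have := at_brk ir; rewrite /stops; lia.
  by move=> j; lia.
have [-> h|//] := eqVneq i ord0.
have : exists q, u q < e q.
  apply/existsP; apply: contraT => /existsPn uE.
  suff : psum u (brk u) = psum e (brk u) by lia.
  apply: psum_full => j _; have /mnm_lepP/(_ j) := ue; have := uE j; lia.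
case=> q1 uq1.
case: (@arg_minnP _ q1 (fun q => u q < e q) (fun q => q : nat) uq1) => q uq qmin.
have full j : j < q -> u j = e j.
  move=> jq; have /mnm_lepP/(_ j) := ue; rewrite leq_eqVlt => /orP[/eqP//|/qmin].
  by lia.
have qr := left_of_brk ue full.
(* The bound for ['X_ord0] is lowered by 1 when [brk u < n.+1], so the prefix is still not full
   after the addition and the old break remains a stop. *)
have rE : brk (u + U_(q))%MM = brk u.
  apply/eqP; rewrite eqn_leq brk_left ?psum_full // andbT.
  have [rn|] := ltnP (brk u) n.+1; last exact/leq_trans/brk_le.
  have := @at_brk u (Ordinal rn) erefl; rewrite /stops /= => /andP[h1 h2].
  apply: (@brk_leP _ (Ordinal rn)); rewrite /stops mnmDE psumD1 /= qr; lia.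
by exists q; split; [split=> // j; apply: full | | apply: code_left].
Qed.

(** One count for both [code] and [code_bound]: the prefix total is replaced by s, and one unit is
    lost at r if r is a position. *)
Lemma mdeg_pack u (r s : nat) : 0 < r -> (forall j, j = r :> nat -> 0 < u j) ->
  mdeg [multinom if i < r then (if i == ord0 then s else 0)
                 else u i - (i == r :> nat) | i < n.+1] + (r < n.+1) + psum u r =
  s + mdeg u.
Proof.
move=> r0 ur; rewrite !mdegE (bigID (fun i : 'I_n.+1 => i < r)) /=.
rewrite [in RHS](bigID (fun i : 'I_n.+1 => i < r)) /= -/(psum u r).
rewrite (bigD1 ord0) //= mnmE r0 eqxx big1 ?addn0 => [|i /andP[ir /negbTE i0]].
  suff -> : \sum_(i < n.+1 | ~~ (i < r)) u i =
     \sum_(i < n.+1 | ~~ (i < r)) (u i - (i == r :> nat)) + (r < n.+1).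
    have -> : \sum_(i < n.+1 | ~~ (i < r)) [multinom if i < r then
        if i == ord0 then s else 0 else u i - (i == r :> nat) | i < n.+1] i =
      \sum_(i < n.+1 | ~~ (i < r)) (u i - (i == r :> nat)).
      by apply: eq_bigr => i /negbTE ir; rewrite mnmE ir.
    by lia.
  have [rn|rn] := ltnP r n.+1; last first.
    by rewrite !big_pred0 // => i; have := ltn_ord i; lia.
  rewrite (bigD1 (Ordinal rn)) /= ?ltnn // [in RHS](bigD1 (Ordinal rn)) /= ?ltnn //.
  rewrite eqxx addnAC subnK ?ur //; congr (_ + _); apply: eq_bigr => i /andP[_ ir].
  by have /negbTE -> : i != r :> nat := ir; rewrite subn0.
by rewrite mnmE ir i0.
Qed.

Lemma mdeg_code u : mdeg (code u) + (brk u < n.+1) = mdeg u.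
Proof.
have h j : j = brk u :> nat -> 0 < u j by move/at_brk => /andP[].
by have := mdeg_pack (psum u (brk u)) (brk_gt0 u) h; rewrite -/(code u); lia.
Qed.

Lemma psum_brk_lt u : brk u < n.+1 -> psum u (brk u) < psum e (brk u).
Proof. by move=> rn; have /andP[] := @at_brk u (Ordinal rn) erefl. Qed.

(** The bound loses two degrees where by [mdeg_code] the codes lose one, so every shifted box is
    symmetric about half of [mdeg e]. *)
Lemma mdeg_code_bound u : (u <= e)%MM ->
  mdeg (code_bound (brk u)) + 2 * (brk u < n.+1) = mdeg e.
Proof.
move=> ue; have h j : j = brk u :> nat -> 0 < e j.
  by move/at_brk => /andP[uj _]; have /mnm_lepP/(_ j) := ue; lia.
have := mdeg_pack (psum e (brk u) - (brk u < n.+1)) (brk_gt0 u) h.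
rewrite -/(code_bound _); have := @psum_brk_lt u.
by case: ltnP => // rn; [move=> /(_ isT); lia | lia].
Qed.

Lemma code_le u : (u <= e)%MM -> (code u <= code_bound (brk u))%MM.
Proof.
move=> ue; apply/mnm_lepP => i; rewrite !mnmE.
have := psum_le (brk u) ue; have := @psum_brk_lt u; have /mnm_lepP/(_ i) := ue.
case: ifP => _; last by lia.
by case: ifP => // _; case: (ltnP (brk u)) => rn h; [move=> /(_ isT); lia | lia].
Qed.

End Codes.

(** * The limit at t = 0 as a direct sum of monomial complete intersections *)

Section BoxMonomials.
Variables (n : nat) (e : 'X_{1..n.+1}).

(** The ambient type of multinomials of bounded degree provides the finite type structure. *)
Definition box := {m : 'X_{1..n.+1 < (mdeg e).+1} | (bmnm m <= e)%MM}.

Definition box_size := #|{: box}|.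

Definition box_mon (i : 'I_box_size) : 'X_{1..n.+1} := bmnm (val (enum_val i)).

Lemma box_mon_le i : (box_mon i <= e)%MM.
Proof. exact: valP (enum_val i). Qed.

Lemma box_mon_inj : injective box_mon.
Proof. by move=> i k /val_inj/val_inj/enum_val_inj. Qed.

Lemma box_mon_surj m : (m <= e)%MM -> exists i, box_mon i = m.
Proof.
move=> me; have md : (mdeg m < (mdeg e).+1)%N.
  by rewrite ltnS !mdegE; apply: leq_sum => i _; apply/mnm_lepP.
exists (enum_rank (exist _ (BMultinom md) me : box)).
by rewrite /box_mon enum_rankK.
Qed.

(** The involution is complementation, sending m to [e - m]. *)
Lemma box_flip : exists2 flip : 'I_box_size -> 'I_box_size, involutive flip &
  forall i, (mdeg (box_mon (flip i)) + mdeg (box_mon i))%N = mdeg e.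
Proof.
have [flip flipE] := fin_all_exists (fun i => box_mon_surj (lem_subr e (box_mon i))).
exists flip => i; last by rewrite flipE -mdegD submK ?box_mon_le.
apply: box_mon_inj; rewrite !flipE; apply/mnmP => l; rewrite !mnmBE subKn //.
exact/mnm_lepP/box_mon_le.
Qed.

Variables (K : fieldType) (charK0 : [pchar K] =i pred0).

(* The multiplication by var_sum on the direct sum, over r, of the box algebras
   with bounds code_bound e r, in the basis of the codes. *)
Definition limit_mx : 'M[K]_box_size := \matrix_(i, k)
  \sum_l ((brk e (box_mon k) == brk e (box_mon i)) &&
          (code e (box_mon k) == (code e (box_mon i) + U_(l))%MM))%:R.

Definition code_poly (r : nat) (v : 'rV[K]_box_size) : {mpoly K[n.+1]} :=
  \sum_(i | brk e (box_mon i) == r) v 0 i *: 'X_[code e (box_mon i)].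

(** For m within the bound, each way of writing m as a code of box r times a variable is realised by
    exactly one basis monomial: it exists by [settles_code] and is unique by [code_inj]. *)
Lemma code_poly_mulmx r v : trunc_zero (code_bound e r)
  (code_poly r (v *m limit_mx) - var_sum K n.+1 * code_poly r v).
Proof.
move=> m mr; rewrite mcoeffB; apply/eqP; rewrite subr_eq0; apply/eqP.
pose A (i : 'I_box_size) : K := \sum_l ((brk e (box_mon i) == r) &&
  ((code e (box_mon i) + U_(l))%MM == m))%:R.
transitivity (\sum_i v 0 i * A i); last first.
  rewrite /code_poly mulr_sumr raddf_sum [RHS]big_mkcond /=; apply: eq_bigr => i _.
  rewrite /A; case: ifP => _ /=; last by rewrite big1 ?mulr0.
  rewrite -scalerAr mcoeffZ mulr_suml raddf_sum /=; congr (_ * _).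
  by apply: eq_bigr => l _; rewrite -mpolyXD mcoeffX addmC.
rewrite /code_poly raddf_sum /=.
under eq_bigr => k kr.
  rewrite mcoeffZ mcoeffX mxE mulr_suml.
  under eq_bigr => i _ do rewrite -mulrA.
  over.
rewrite exchange_big /=; apply: eq_bigr => i _; rewrite -mulr_sumr; congr (_ * _).
under eq_bigr => k kr do rewrite mxE mulr_suml.
rewrite exchange_big /=; apply: eq_bigr => l _.
have [/andP[/eqP ir /eqP im]|h] := boolP (_ && _); last first.
  rewrite big1 // => k /eqP kr; rewrite -natrM mulnb.
  case: (boolP (_ && _)) => // /andP[/andP[/eqP ki /eqP kl] /eqP km].
  by rewrite -ki kr -kl km !eqxx in h.
have [|q [[iq uq full] rE cE]] := @settles_code _ e _ l (box_mon_le i).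
  by rewrite im ir.
have [k kE] : exists k, box_mon k = (box_mon i + U_(q))%MM.
  apply: box_mon_surj; apply/mnm_lepP => t; rewrite mnmDE mnm1E.
  by have [<-|_] := eqVneq; [rewrite addn1 | rewrite addn0; apply/mnm_lepP/box_mon_le].
rewrite (bigD1 k) /= ?kE ?rE ?ir // cE im !eqxx mulr1 big1 ?addr0 // => k' /andP[/eqP k'r k'k].
rewrite k'r eqxx /=; case: eqP => k'm; last by rewrite mul0r.
case/eqP: k'k; apply: box_mon_inj; apply: (code_inj (box_mon_le _) (box_mon_le _)).
  by rewrite k'r kE rE ir.
by rewrite k'm kE cE im.
Qed.

Lemma code_poly_mulmxX r v s : trunc_zero (code_bound e r)
  (code_poly r (v *m limit_mx ^+ s) - var_sum K n.+1 ^+ s * code_poly r v).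
Proof.
elim: s => [|s IH]; first by move=> m _; rewrite !expr0 mulmx1 mul1r subrr mcoeff0.
rewrite exprSr -mulmxE mulmxA exprS -mulrA.
rewrite -[_ - _](subrKA (var_sum K n.+1 * code_poly r (v *m limit_mx ^+ s))).
rewrite -[X in _ + X]opprB; apply: trunc_zeroB; first exact: code_poly_mulmx.
by rewrite -mulrBr; apply: trunc_zero_var_sum => m mr; rewrite -opprB mcoeffN IH ?oppr0.
Qed.

Lemma limit_mx_injective j v : (2 * j <= mdeg e)%N ->
  in_degree (fun i => mdeg (box_mon i)) j v ->
  v *m limit_mx ^+ (mdeg e - 2 * j)%N = 0 -> v = 0.
Proof.
move=> je vj v0; apply/rowP => i; rewrite mxE.
have [ij|/vj //] := eqVneq (mdeg (box_mon i)) j.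
set r := brk e (box_mon i); set d := (r < n.+1)%N.
have dE := mdeg_code e (box_mon i); have bE := mdeg_code_bound (box_mon_le i).
rewrite -/r -/d in dE bE.
have Ph : code_poly r v \is (j - d)%N.-homog.
  apply: rpred_sum => k /eqP kr; have [kj|/vj ->] := eqVneq (mdeg (box_mon k)) j.
    rewrite dhomogZ // dhomogX /=; apply/eqP.
    by have := mdeg_code e (box_mon k); rewrite kr -/d kj; lia.
  by rewrite scale0r dhomog0.
have := @code_poly_mulmxX r v (mdeg e - 2 * j)%N.
rewrite v0 /code_poly big1 => [|k _]; last by rewrite mxE scale0r.
rewrite sub0r => T0.
have : trunc_zero (code_bound e r) (code_poly r v).
  (* The shift cancels: [mdeg e - 2 * j] equals [mdeg (code_bound e r) - 2 * (j - d)], the middle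
     case of [box_lefschetz]. *)
  apply: (box_lefschetz charK0 Ph (s := (mdeg e - 2 * j)%N)); first by lia.
  by move=> m mr; have := T0 m mr; rewrite mcoeffN => /eqP; rewrite oppr_eq0 => /eqP.
move=> /(_ _ (code_le (box_mon_le i))); rewrite raddf_sum /= (bigD1 i) //= big1.
  by rewrite addr0 mcoeffZ mcoeffX eqxx mulr1.
move=> k /andP[/eqP kr ki]; rewrite mcoeffZ mcoeffX; case: eqP => kc; last by rewrite mulr0.
by case/eqP: ki; apply: box_mon_inj; apply: (code_inj (box_mon_le _) (box_mon_le _)).
Qed.

End BoxMonomials.

(** * Normal forms and regularity *)

Section MonomialMaps.
Variables (R : nzRingType) (n : nat) (f : 'X_{1..n} -> 'X_{1..n}).

Definition mon_map (p : {mpoly R[n]}) : {mpoly R[n]} :=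
  \sum_(m <- msupp p) p@_m *: 'X_[f m].

Lemma mon_mapwE k p : (msize p <= k)%N ->
  mon_map p = \sum_(m : 'X_{1..n < k}) p@_m *: 'X_[f m].
Proof.
move=> pk; pose I : subFinType _ := 'X_{1..n < k}.
rewrite /mon_map (big_mksub I) //=; first last.
- by move=> m /msize_mdeg_lt /leq_trans; apply.
- by rewrite msupp_uniq.
by rewrite big_rmcond //= => i /memN_msupp_eq0 ->; rewrite scale0r.
Qed.

Lemma mon_map_is_linear : linear mon_map.
Proof.
move=> c p q; pose k := maxn (msize (c *: p + q)) (maxn (msize p) (msize q)).
rewrite !(@mon_mapwE k) ?leq_max ?leqnn ?orbT //.
rewrite scaler_sumr -big_split /=; apply: eq_bigr => m _.
by rewrite mcoeffD mcoeffZ scalerDl scalerA.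
Qed.

HB.instance Definition _ :=
  GRing.isLinear.Build R {mpoly R[n]} {mpoly R[n]} _ mon_map mon_map_is_linear.

Lemma mon_mapX m : mon_map 'X_[m] = 'X_[f m].
Proof. by rewrite /mon_map msuppX big_seq1 mcoeffX eqxx scale1r. Qed.

Lemma mon_map_neq0 p m : (mon_map p)@_m != 0 -> exists2 m', m' \in msupp p & m = f m'.
Proof.
rewrite raddf_sum /= => h; have : has (fun m' => f m' == m) (msupp p).
  apply: contraNT h => /hasPn h; rewrite big_seq big1 // => m' /h /negbTE.
  by rewrite mcoeffZ mcoeffX => ->; rewrite mulr0.
by case/hasP=> m' pm' /eqP <-; exists m'.
Qed.

End MonomialMaps.

Lemma mon_map_mulX (R : comNzRingType) n (f : 'X_{1..n} -> 'X_{1..n}) w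
    (p : {mpoly R[n]}) :
  (forall m, f (m + w)%MM = (f m + w)%MM) ->
  mon_map f ('X_[w] * p) = 'X_[w] * mon_map f p.
Proof.
move=> fw; rewrite [in LHS](mpolyE p) /mon_map -/(mon_map f _) mulr_sumr raddf_sum.
rewrite mulr_sumr; apply: eq_bigr => m _ /=.
by rewrite -!scalerAr linearZ /= -!mpolyXD mon_mapX addmC fw addmC.
Qed.

Lemma seq_argmax (T : eqType) (s : seq T) (f : T -> nat) : s != [::] ->
  exists2 x, x \in s & forall y, y \in s -> (f y <= f x)%N.
Proof.
elim: s => // x s IH _; have [->|/IH[y ys ymax]] := eqVneq s [::].
  by exists x; rewrite ?mem_head // => y; rewrite inE => /eqP ->.
have [xy|/ltnW yx] := leqP (f x) (f y).
  by exists y; rewrite ?inE ?ys ?orbT // => z /predU1P[->|/ymax].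
exists x; rewrite ?mem_head // => z /predU1P[->//|/ymax zy].
exact: leq_trans yx.
Qed.

Lemma ideal_sum (A : comNzRingType) (J : A -> Prop) (I : Type) (r : seq I) (P : pred I) F :
  is_ideal J -> (forall i, P i -> J (F i)) -> J (\sum_(i <- r | P i) F i).
Proof. by case=> J0 JD _ JF; elim/big_ind: _. Qed.

Lemma ideal_gen_mem (A : comNzRingType) (fs : seq A) f : f \in fs -> ideal_gen fs f.
Proof.
move=> ff; have fi : (index f fs < size fs)%N by rewrite index_mem.
exists (fun i => (i == Ordinal fi)%:R); rewrite (bigD1 (Ordinal fi)) //= eqxx mul1r.
by rewrite nth_index // big1 ?addr0 // => i /negbTE ->; rewrite mul0r.
Qed.

Section CyclicIdeal.
Variables (K : fieldType) (n : nat) (d : 'I_n.+1 -> nat) (a : K).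
Local Notation R := {mpoly K[n.+1]}.
Local Notation g := (cyc_generator d a).
Implicit Types (m w : 'X_{1..n.+1}) (p : R).

Definition cyc_exp : 'X_{1..n.+1} := [multinom d (ordS i) | i < n.+1].
Local Notation e := cyc_exp.

Lemma ordS_max : ordS (@ord_max n) = ord0.
Proof. by apply: val_inj; rewrite /= modnn. Qed.

Lemma ordS_val (i : 'I_n.+1) : (i < n)%N -> ordS i = i.+1 :> nat.
Proof. by move=> i_n /=; rewrite modn_small. Qed.

Lemma cyc_generator_lt (i : 'I_n.+1) : (i < n)%N ->
  g i = 'X_[U_(i) *+ (e i).+1] - 'X_[U_(i) *+ e i + U_(ordS i)].
Proof.
move=> i_n; rewrite /cyc_generator; case: eqP => [im|_].
  by rewrite im ltnn in i_n.
by rewrite mulrBr mnmE -exprSr mpolyXD -!mpolyXn.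
Qed.

Lemma cyc_generator_max :
  g ord_max = 'X_[U_(ord_max) *+ e ord_max] * ('X_ord_max - a *: 'X_ord0).
Proof. by rewrite /cyc_generator eqxx mnmE ordS_max mpolyXn. Qed.

(** The ideal of the first i generators, with coefficients indexed by a fixed type; [take_gen_ideal]
    relates it to [ideal_gen]. *)
Definition gen_ideal (i : nat) (p : R) :=
  exists c : 'I_n.+1 -> R, p = \sum_(k < n.+1 | (k < i)%N) c k * g k.

Lemma gen_ideal_ideal i : is_ideal (gen_ideal i).
Proof.
split=> [|_ _ [b ->] [c ->]|p _ [c ->]].
- by exists (fun=> 0); rewrite big1 // => k _; rewrite mul0r.
- exists (fun k => b k + c k); rewrite -big_split /=.
  by apply: eq_bigr => k _; rewrite mulrDl.
- exists (fun k => p * c k); rewrite mulr_sumr.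
  by apply: eq_bigr => k _; rewrite mulrA.
Qed.

Lemma gen_ideal_gen i (k : 'I_n.+1) : (k < i)%N -> gen_ideal i (g k).
Proof.
move=> ki; exists (fun l => (l == k)%:R).
rewrite (bigD1 k) //= eqxx mul1r big1 ?addr0 // => l /andP[_ /negbTE ->].
by rewrite mul0r.
Qed.

Lemma gen_ideal_mono i j p : (i <= j)%N -> gen_ideal i p -> gen_ideal j p.
Proof.
move=> ij [c ->]; have [_ _ JM] := gen_ideal_ideal j.
apply: ideal_sum (gen_ideal_ideal j) _ => k ki; apply/JM/gen_ideal_gen.
exact: leq_trans ij.
Qed.

(* Rewriting with 'X_j ^+ (e j).+1 = 'X_j ^+ e j * 'X_(ordS j): the excess of the
   j-th exponent over e j moves to the next variable. *)
Definition push (j : 'I_n.+1) (m : 'X_{1..n.+1}) : 'X_{1..n.+1} :=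
  (m - U_(j) *+ (m j - e j) + U_(ordS j) *+ (m j - e j))%MM.

(** One pass from left to right suffices, as the push at a position j < n only feeds position j + 1,
    which is treated next. *)
Fixpoint push_upto (i : nat) (m : 'X_{1..n.+1}) : 'X_{1..n.+1} :=
  if i is i'.+1 then push (inord i') (push_upto i' m) else m.

Lemma pushE j m k : push j m k =
  (m k - (j == k) * (m j - e j) + (ordS j == k) * (m j - e j))%N.
Proof. by rewrite /push mnmDE mnmBE !mulmnE !mnm1E. Qed.

Lemma push_add j m w : w j = 0%N -> push j (m + w)%MM = (push j m + w)%MM.
Proof.
move=> wj; apply/mnmP => k; rewrite mnmDE !pushE !mnmDE wj addn0.
by have [<-|_] := eqVneq; rewrite ?wj ?mul0n; lia.
Qed.

Lemma push_upto_add i m w : (i <= n)%N -> (forall k : 'I_n.+1, (k < i)%N -> w k = 0%N) ->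
  push_upto i (m + w)%MM = (push_upto i m + w)%MM.
Proof.
elim: i => //= i IH i_n wi.
rewrite IH ?(ltnW i_n) //; last by move=> k ki; apply/wi/ltnW.
by rewrite push_add // wi // inordK // ltnS ltnW.
Qed.

Lemma push_generator (j : 'I_n.+1) m : (j < n)%N ->
  push j (m + U_(j) *+ (e j).+1)%MM = push j (m + (U_(j) *+ e j + U_(ordS j)))%MM.
Proof.
move=> jn; apply/mnmP => k; rewrite !pushE !mnmDE !mulmnE !mnm1E.
have -> : (ordS j == j) = false.
  by apply/eqP => /(congr1 (@nat_of_ord _)); rewrite ordS_val //; lia.
rewrite eqxx; have [<-|_] := eqVneq j k; last by lia.
have -> : (ordS j == j) = false.
  by apply/eqP => /(congr1 (@nat_of_ord _)); rewrite ordS_val //; lia.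
by lia.
Qed.

(** The pushes before j do not see the variables j and [ordS j], and the push at j carries both
    terms of the generator to the same monomial. *)
Lemma push_upto_generator i (j : 'I_n.+1) m : (j < i <= n)%N ->
  push_upto i (m + U_(j) *+ (e j).+1)%MM =
  push_upto i (m + (U_(j) *+ e j + U_(ordS j)))%MM.
Proof.
elim: i => // i IH /andP[ji i_n]; have jn : (j < n)%N by lia.
have [jE|jE] := eqVneq (nat_of_ord j) i; last by rewrite /= IH //; lia.
have Ej : inord i = j by apply: val_inj; rewrite /= inordK -?jE.
have Z s t : forall k : 'I_n.+1, (k < i)%N ->
    (U_(j) *+ s + U_(ordS j) *+ t)%MM k = 0%N.
  move=> k ki; rewrite mnmDE !mulmnE !mnm1E.
  have -> : (j == k) = false by apply/eqP => jk; rewrite -jk in ki; lia.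
  have -> : (ordS j == k) = false.
    by apply/eqP => jk; have := ordS_val jn; rewrite jk; lia.
  by [].
have := Z (e j).+1 0%N; rewrite mulm0n addm0 => Z1.
have := Z (e j) 1%N; rewrite mulm1n => Z2.
by rewrite /= !push_upto_add ?(ltnW i_n) // Ej push_generator.
Qed.

Lemma push_upto_le i (k : 'I_n.+1) m : (k < i <= n)%N -> (push_upto i m k <= e k)%N.
Proof.
elim: i => // i IH /andP[ki i_n] /=; rewrite pushE.
have iK : inord i = i :> nat := @inordK n i ltac:(lia).
have Sk : (ordS (inord i : 'I_n.+1) == k) = false.
  by apply/eqP => Sk; have := @ordS_val (inord i); rewrite iK Sk => /(_ i_n); lia.
rewrite Sk addn0; have [<-|ik] := eqVneq; first by lia.
rewrite subn0; apply: IH; have : nat_of_ord k != i; last by lia.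
by apply: contraNneq ik => ki'; apply/eqP/val_inj; rewrite /= iK.
Qed.

Lemma push_upto_id i m : (i <= n)%N -> (forall k : 'I_n.+1, (k < i)%N -> (m k <= e k)%N) ->
  push_upto i m = m.
Proof.
elim: i => //= i IH i_n mi; rewrite IH ?(ltnW i_n) //; last first.
  by move=> k ki; apply/mi/ltnW.
have iK : inord i = i :> nat := @inordK n i ltac:(lia).
have := mi (inord i); rewrite iK ltnSn => /(_ isT) h.
by apply/mnmP => k; rewrite pushE; lia.
Qed.

Lemma push_upto_add1 i m : (i <= n)%N ->
  (forall k : 'I_n.+1, (k < i)%N -> (m k <= e k)%N) ->
  exists q, push_upto i (m + U_(ord0))%MM = (m + U_(q))%MM.
Proof.
elim: i => [|i IH] i_n mi; first by exists ord0.
have [|q /= ->] := IH (ltnW i_n); first by move=> k ki; apply/mi/ltnW.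
have iK : inord i = i :> nat := @inordK n i ltac:(lia).
have mj := mi (inord i); rewrite iK ltnSn in mj; have {}mj := mj isT.
have Sk : (ordS (inord i : 'I_n.+1) == inord i) = false.
  by apply/eqP => Sk; have := @ordS_val (inord i); rewrite iK Sk iK => /(_ i_n); lia.
have [qi|qi] := boolP ((q == inord i) && (m q == e q)); last first.
  exists q; apply/mnmP => k; rewrite pushE !mnmDE !mnm1E; move: qi.
  by have [->|_] := eqVneq q (inord i) => /= qi; lia.
have [/eqP qE /eqP me] := andP qi; rewrite qE in me *.
exists (ordS (inord i)); apply/mnmP => k; rewrite pushE !mnmDE !mnm1E eqxx me.
have [<-|_] := eqVneq (inord i) k; first by rewrite me Sk; lia.
by lia.
Qed.

(* Normal form modulo the first i generators, for i <= n; it is linear over the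
   polynomials in the remaining variables. *)
Definition nf i : R -> R := mon_map (push_upto i).

Lemma nfB i p q : nf i (p - q) = nf i p - nf i q.
Proof. exact: raddfB. Qed.

Lemma nfZ i c p : nf i (c *: p) = c *: nf i p.
Proof. exact: linearZ. Qed.

Lemma nf_sum i (I : Type) (r : seq I) (P : pred I) (F : I -> R) :
  nf i (\sum_(k <- r | P k) F k) = \sum_(k <- r | P k) nf i (F k).
Proof. exact: raddf_sum. Qed.

Lemma nfX i m : nf i 'X_[m] = 'X_[push_upto i m].
Proof. exact: mon_mapX. Qed.

Lemma nf_mulX i w p : (i <= n)%N -> (forall k : 'I_n.+1, (k < i)%N -> w k = 0%N) ->
  nf i ('X_[w] * p) = 'X_[w] * nf i p.
Proof. by move=> i_n wi; apply: mon_map_mulX => m; rewrite push_upto_add. Qed.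

Lemma nf_gen_ideal i p : (i <= n)%N -> gen_ideal i p -> nf i p = 0.
Proof.
move=> i_n [c ->]; rewrite /nf raddf_sum big1 //= => j ji.
rewrite [c j]mpolyE mulr_suml raddf_sum big1 //= => m _.
rewrite -scalerAl linearZ /= cyc_generator_lt; last by apply: leq_trans i_n.
rewrite mulrBr -!mpolyXD raddfB /= !mon_mapX push_upto_generator ?ji //.
by rewrite subrr scaler0.
Qed.

(** With x the excess at j, the difference contains the factor ['X_j ^+ x - 'X_(ordS j) ^+ x], which
    is divisible by ['X_j - 'X_(ordS j)]. *)
Lemma push_gen_ideal (j : 'I_n.+1) i m : (j < i)%N -> (j < n)%N ->
  gen_ideal i ('X_[m] - 'X_[push j m]).
Proof.
move=> ji jn; have [J0 JD JM] := gen_ideal_ideal i.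
have [xm|mx] := leqP (m j) (e j).
  have -> : push j m = m by apply/mnmP => k; rewrite pushE; lia.
  by rewrite subrr.
set x := (m j - e j)%N; pose m0 := (m - U_(j) *+ m j)%MM.
have mE : m = (m0 + U_(j) *+ e j + U_(j) *+ x)%MM.
  apply/mnmP => k; rewrite !mnmDE mnmBE !mulmnE !mnm1E.
  by have [<-|_] := eqVneq; rewrite /x; lia.
have pE : push j m = (m0 + U_(j) *+ e j + U_(ordS j) *+ x)%MM.
  apply/mnmP => k; rewrite pushE !mnmDE mnmBE !mulmnE !mnm1E -/x.
  by have [<-|_] := eqVneq; rewrite /x; lia.
rewrite pE {1}mE !mpolyXD -mulrBr -!mpolyXn subrXX.
set S := \sum_(_ < x) _; have gE : g j = 'X_j ^+ e j * ('X_j - 'X_(ordS j)).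
  by rewrite /cyc_generator mnmE; case: eqP => // jm; rewrite jm ltnn in jn.
have -> : 'X_[m0] * 'X_j ^+ e j * (('X_j - 'X_(ordS j)) * S) = 'X_[m0] * S * g j.
  by rewrite gE; ring.
exact/JM/gen_ideal_gen.
Qed.

Lemma nf_congr i p : (i <= n)%N -> gen_ideal i (p - nf i p).
Proof.
move=> i_n; have [J0 JD JM] := gen_ideal_ideal i.
rewrite [in X in X - _](mpolyE p) /nf /mon_map -sumrB.
apply: ideal_sum (gen_ideal_ideal i) _ => m _.
rewrite -scalerBr -mul_mpolyC; apply: JM => {J0 JD p}.
elim: i i_n => [|i IH] i_n /=; first by rewrite subrr; case: (gen_ideal_ideal 0).
have iK : inord i = i :> nat := @inordK n i ltac:(lia).
have [_ JD _] := gen_ideal_ideal i.+1.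
rewrite -[_ - _](subrKA 'X_[push_upto i m]); apply: JD.
  exact/(gen_ideal_mono (leqnSn i))/IH/ltnW.
by apply: push_gen_ideal; rewrite iK.
Qed.

Lemma nf_eq0 i p : (i <= n)%N -> nf i p = 0 -> gen_ideal i p.
Proof. by move=> i_n p0; have := nf_congr p i_n; rewrite p0 subr0. Qed.

Lemma nf_supp p m (k : 'I_n.+1) : (nf n p)@_m != 0 -> (k < n)%N -> (m k <= e k)%N.
Proof. by case/mon_map_neq0 => m' _ -> kn; apply: push_upto_le; rewrite kn leqnn. Qed.

Lemma nf_id p : (forall m (k : 'I_n.+1), p@_m != 0 -> (k < n)%N -> (m k <= e k)%N) ->
  nf n p = p.
Proof.
move=> ps; rewrite [RHS]mpolyE /nf /mon_map; apply: eq_big_seq => m.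
by rewrite mcoeff_msupp => pm; rewrite push_upto_id // => k; apply: ps.
Qed.

Hypothesis a_neq1 : a != 1.

(* If m is a monomial of h with the largest last exponent, then in normal form
   'X_ord0 * h contains 'X_[m + U_(ord_max)] with coefficient h@_m or 0, so that
   ('X_ord_max - a *: 'X_ord0) * h contains it with (1 - a) * h@_m or h@_m. *)
Lemma nf_generator_max (h : R) : h != 0 -> nf n h = h ->
  exists2 m : 'X_{1..n.+1}, (e ord_max < m ord_max)%N & (nf n (g ord_max * h))@_m != 0.
Proof.
move=> h0 hN; have h0' : msupp h != [::] by rewrite msupp_eq0.
have [m mh mmax] := seq_argmax (fun m : 'X_{1..n.+1} => m ord_max) h0'.
have maxZ (k : 'I_n.+1) s : (k < n)%N -> (U_(ord_max) *+ s)%MM k = 0%N.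
  by move=> kn; rewrite mulmnE mnm1E; case: eqP kn => // <-; rewrite ltnn.
have maxZ1 (k : 'I_n.+1) : (k < n)%N -> (U_(ord_max) : 'X_{1..n.+1})%MM k = 0%N.
  by move=> kn; have := maxZ k 1%N kn; rewrite mulm1n.
exists (U_(ord_max) *+ e ord_max + (U_(ord_max) + m))%MM.
  by rewrite !mnmDE mulmnE mnm1E eqxx; lia.
rewrite cyc_generator_max -mulrA nf_mulX // => [|k kn]; last exact: maxZ.
rewrite ['X_[(U_(ord_max) *+ _)] * _]mulrC mcoeffMX mulrBl -scalerAl nfB nfZ.
rewrite nf_mulX // hN mcoeffB mcoeffZ mulrC mcoeffMX.
have -> : (nf n ('X_ord0 * h))@_(U_(ord_max) + m) =
    h@_m * (push_upto n (m + U_(ord0)) == U_(ord_max) + m)%MM%:R.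
  rewrite [in LHS](mpolyE h) mulr_sumr nf_sum raddf_sum /= (bigD1_seq m) ?msupp_uniq //=.
  rewrite -scalerAr nfZ -mpolyXD nfX mcoeffZ mcoeffX addmC.
  rewrite big_seq_cond big1 ?addr0 // => m' /andP[m'h m'm].
  rewrite -scalerAr nfZ -mpolyXD nfX mcoeffZ mcoeffX addmC.
  have [|q ->] := @push_upto_add1 n m' (leqnn n).
    by move=> k kn; rewrite mcoeff_msupp -hN in m'h; apply: nf_supp m'h kn.
  case: eqP => [/mnmP E|]; last by rewrite mulr0.
  (* For any other q the last exponent of m' would exceed that of m, against the choice of m. *)
  have qm : q = ord_max.
    have := E ord_max; rewrite !mnmDE !mnm1E eqxx.
    by have := mmax _ m'h; case: eqP => //; lia.
  case/eqP: m'm; apply/mnmP => k; have := E k; rewrite !mnmDE qm; lia.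
rewrite mcoeff_msupp in mh.
case: (push_upto n _ == _); rewrite ?mulr1 ?mulr0 ?subr0 //.
by rewrite -{1}[h@_m]mul1r -mulrBl mulf_neq0 // subr_eq0 eq_sym.
Qed.

Lemma cyc_generator_neq0 (i : 'I_n.+1) : (i < n)%N -> g i != 0.
Proof.
move=> i_n; rewrite cyc_generator_lt // subr_eq0; apply/eqP.
move/(congr1 (fun p => p@_(U_(i) *+ (e i).+1)%MM)); rewrite !mcoeffX eqxx.
case: eqP => [/mnmP/(_ i)|_ /eqP]; last by rewrite oner_eq0.
rewrite mnmDE !mulmnE !mnm1E eqxx => E _.
have : ordS i == i by apply: contraLR isT => /negbTE h; rewrite h in E; lia.
by move/eqP/(congr1 (@nat_of_ord _)); rewrite ordS_val //; lia.
Qed.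

(** For i < n the generator involves only variables of index at least i, over which [nf i] is
    linear, and the polynomial ring is a domain. For the last generator [nf_generator_max] excludes
    a nonzero normal form. *)
Lemma cyc_generator_regular (i : 'I_n.+1) p :
  gen_ideal i (g i * p) -> gen_ideal i p.
Proof.
have := ltn_ord i; rewrite ltnS leq_eqVlt => /orP[/eqP i_n|i_n] gp.
  have iE : i = ord_max by apply: val_inj.
  rewrite i_n in gp *; apply: nf_eq0 => //; apply/eqP; apply: contraT => p0.
  have [|m _] := nf_generator_max p0.
    by apply: nf_id => m k; apply: nf_supp.
  suff -> : nf n (g ord_max * nf n p) = 0 by rewrite mcoeff0 eqxx.
  apply: nf_gen_ideal => //; have [_ JD JM] := gen_ideal_ideal n.
  rewrite -[nf n p](subKr p) mulrBr; apply: JD; first by rewrite -iE.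
  by rewrite -mulrN -mulN1r mulrCA; apply/JM/JM/nf_congr.
apply: nf_eq0; first exact: ltnW.
have : nf i (g i * p) = 0 by apply: nf_gen_ideal gp; apply: ltnW.
rewrite {1}cyc_generator_lt // mulrBl nfB.
have maxZ (k l : 'I_n.+1) s : (k < i)%N -> (i <= l)%N -> (U_(l) *+ s)%MM k = 0%N.
  move=> ki il; rewrite mulmnE mnm1E.
  by have -> : (l == k) = false by apply/eqP => lk; rewrite lk in il; lia.
rewrite !nf_mulX ?(ltnW i_n) //; first last.
- by move=> k ki; apply: maxZ.
- move=> k ki; rewrite mnmDE maxZ // -[U_(ordS i)%MM]mulm1n maxZ //.
  by rewrite ordS_val.
rewrite -mulrBl -cyc_generator_lt // => /eqP.
by rewrite mulf_eq0 (negbTE (cyc_generator_neq0 i_n)) => /eqP.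
Qed.

(** This is the independence of the box monomials. Such a p is the normal form of a multiple of the
    last generator, and unless the multiplier has normal form 0 it contains a monomial whose last
    exponent exceeds [e ord_max]. *)
Lemma gen_ideal_box p : (forall m, p@_m != 0 -> (m <= e)%MM) ->
  gen_ideal n.+1 p -> p = 0.
Proof.
move=> pe [c]; rewrite (bigD1 ord_max) //=; set y := \sum_(k < _ | _) _ => pE.
have yJ : gen_ideal n y.
  apply: ideal_sum (gen_ideal_ideal n) _ => k /andP[_ km].
  have [_ _ JM] := gen_ideal_ideal n; apply/JM/gen_ideal_gen.
  have := ltn_ord k; rewrite ltnS leq_eqVlt => /orP[/eqP kn|//].
  by case/eqP: km; apply: val_inj.
have pN : nf n p = p by apply: nf_id => m k /pe/mnm_lepP.
have [_ JD JM] := gen_ideal_ideal n.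
have {}pE : p = nf n (g ord_max * nf n (c ord_max)).
  rewrite -pN; apply/eqP; rewrite -subr_eq0 -nfB; apply/eqP.
  apply: nf_gen_ideal => //; rewrite {1}pE addrAC; apply: JD => //.
  by rewrite mulrC -mulrBr; apply/JM/nf_congr.
have [c0|c0] := eqVneq (nf n (c ord_max)) 0; first by rewrite pE c0 mulr0 /nf raddf0.
have [|m me] := nf_generator_max c0; first by apply: nf_id => m k; apply: nf_supp.
by rewrite -pE => /pe/mnm_lepP/(_ ord_max); rewrite leqNgt me.
Qed.

Lemma take_gen_ideal i p : (i <= n.+1)%N ->
  ideal_gen (take i (cyc_generators d a)) p <-> gen_ideal i p.
Proof.
move=> i_n; have sz : size (take i (cyc_generators d a)) = i.
  by rewrite size_takel // size_map size_enum_ord.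
have nthE (k : 'I_n.+1) : (k < i)%N -> (take i (cyc_generators d a))`_k = g k.
  by move=> ki; rewrite nth_take // (nth_map ord0) ?size_enum_ord // nth_ord_enum.
split=> [[c ->]|[c ->]].
  apply: ideal_sum (gen_ideal_ideal i) _ => k _.
  have ki : (k < i)%N by rewrite -[X in (_ < X)%N]sz.
  have kn : (k < n.+1)%N by apply: leq_trans i_n.
  have [_ _ JM] := gen_ideal_ideal i; apply: JM.
  by rewrite (nthE (Ordinal kn)) //; apply: gen_ideal_gen.
apply: ideal_sum (ideal_gen_ideal _) _ => k ki.
have [_ _ JM] := ideal_gen_ideal (take i (cyc_generators d a)); apply/JM/ideal_gen_mem.
by rewrite -nthE // mem_nth // sz.
Qed.

Lemma mem_cyc_ideal p : p \in cyc_ideal d a <-> gen_ideal n.+1 p.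
Proof.
have sz : size (cyc_generators d a) = n.+1 by rewrite size_map size_enum_ord.
rewrite -(take_gen_ideal p (leqnn _)) take_oversize ?sz //.
by split=> [/asboolP|?] //; apply/asboolP.
Qed.

Lemma cyc_complete_intersection : complete_intersection (cyc_ideal d a).
Proof.
have sz : size (cyc_generators d a) = n.+1 by rewrite size_map size_enum_ord.
exists (cyc_generators d a); split=> [f /mapP[i _ ->]|| p]; last first.
- by split=> [/asboolP|?] //; apply/asboolP.
- split=> [h|i].
    have : (1 : R) \in cyc_ideal d a by apply/asboolP.
    by rewrite idealr1.
  rewrite sz => i_n p; rewrite !take_gen_ideal ?(ltnW i_n) //.
  rewrite (nth_map ord0) ?size_enum_ord // (nth_ord_enum ord0 (Ordinal i_n)).
  exact: cyc_generator_regular.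
have X1 (k : 'I_n.+1) : ('X_k : R) \is 1.-homog by rewrite dhomogX /= mdeg1.
have Xs (k : 'I_n.+1) s : ('X_k : R) ^+ s \is s.-homog.
  by have := dhomogMn s (X1 k); rewrite mul1n.
rewrite /cyc_generator; case: ifP => _; eexists; apply: dhomogM (Xs _ _) _;
  by apply: (rpredB (X1 _)); rewrite ?X1 //; apply/dhomogZ/X1.
Qed.

End CyclicIdeal.

(** * Straightening *)

Section SubspaceChains.
Variables (K : fieldType) (m : nat).

(** A row space inside W is enlarged by vectors of W that it misses; the rank grows each time, so
    this stops. *)
Lemma subspace_mx (W : 'rV[K]_m -> Prop) :
  W 0 -> (forall u v, W u -> W v -> W (u + v)) -> (forall c v, W v -> W (c *: v)) ->
  exists A : 'M[K]_m, forall v, W v <-> (v <= A)%MS.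
Proof.
move=> W0 WD WZ; have: exists A : 'M[K]_m, forall v : 'rV_m, (v <= A)%MS -> W v.
  by exists 0 => v; rewrite submx0 => /eqP ->.
case=> A; have [k] := ubnP (m - \rank A)%N; elim: k A => // k IH A Ak WA.
have [AW|] := EM (forall v, W v -> (v <= A)%MS).
  by exists A => v; split; [exact: AW | exact: WA].
move=> /asboolPn/existsp_asboolPn[v /asboolPn/imply_asboolPn[Wv vA]].
have rkA : (\rank A < \rank (A + v)%MS)%N.
  have /mxrank_leqif_sup lt := addsmxSl A v; rewrite ltn_neqAle !lt andbT.
  by rewrite addsmx_sub submx_refl; apply/negP.
apply: (IH (A + v)%MS).
  by have := rank_leq_row (A + v)%MS; lia.
move=> u /sub_addsmxP[[u1 u2] /= ->]; apply: WD.
  by apply: WA; apply: submxMl.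
by rewrite [u2]mx11_scalar mul_scalar_mx; apply: WZ.
Qed.

Lemma subspace_dcc (W : nat -> 'rV[K]_m -> Prop) :
  (forall i, W i 0) -> (forall i u v, W i u -> W i v -> W i (u + v)) ->
  (forall i c v, W i v -> W i (c *: v)) -> (forall i v, W i.+1 v -> W i v) ->
  exists N, forall i, (N <= i)%N -> forall v, W N v -> W i v.
Proof.
move=> W0 WD WZ Wdec.
have [A AW] := choice (fun i => subspace_mx (W0 i) (WD i) (WZ i)).
have Wle i j v : (i <= j)%N -> W j v -> W i v.
  by elim: j => [|j IH]; [rewrite leqn0 => /eqP -> | rewrite leq_eqVlt => /predU1P[->//|ij /Wdec/(IH ij)]].
have Ale i j : (i <= j)%N -> (A j <= A i)%MS.
  by move=> ij; apply/row_subP => k; apply/AW/(Wle i j) => //; apply/AW/row_sub.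
suff H r i0 : (\rank (A i0) < r)%N ->
    exists N, forall i, (N <= i)%N -> forall v, W N v -> W i v.
  exact: (H _ 0%N (ltnSn _)).
elim: r i0 => // r IH i0 i0r.
have [h|h] := EM (exists2 j, (i0 <= j)%N & (\rank (A j) < \rank (A i0))%N).
  by have [j ij jr] := h; apply: (IH j); lia.
exists i0 => j ij v /AW vA; apply/AW/(submx_trans vA).
have /mxrank_leqif_sup rk := Ale _ _ ij; rewrite -rk eqn_leq rk leqNgt.
by apply/negP => lt; apply: h; exists j.
Qed.

End SubspaceChains.

(** * Products of a variable and a basis monomial modulo the ideal *)

Section Straightening.
Variables (K : fieldType) (n : nat) (d : 'I_n.+1 -> nat) (a : K).
Hypothesis a_neq1 : a != 1.
Local Notation R := {mpoly K[n.+1]}.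
Local Notation I := (cyc_ideal d a).
Local Notation e := (cyc_exp d).
Implicit Types (u v m : 'X_{1..n.+1}) (p : R).

Lemma idealZ (c : K) p : p \in I -> c *: p \in I.
Proof. by rewrite -mul_mpolyC; apply: idealMr. Qed.

Lemma cyc_step (i : 'I_n.+1) u : u i = e i ->
  'X_i * 'X_[u] - (if i == ord_max then a else 1) *: ('X_(ordS i) * 'X_[u]) \in I.
Proof.
move=> ui; have gI : cyc_generator d a i \in I.
  by apply/mem_cyc_ideal => //; apply: gen_ideal_gen.
have -> : 'X_[u] = 'X_[(u - U_(i) *+ e i)] * 'X_i ^+ e i :> R.
  rewrite mpolyXn -mpolyXD submK //; apply/mnm_lepP => k.
  by rewrite mulmnE mnm1E; case: eqP => [<-|]; rewrite ?mul1n ?ui.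
move: gI => /(idealMr 'X_[(u - U_(i) *+ e i)]).
congr (_ \in I); rewrite /cyc_generator; case: ifP => [/eqP ->|_].
  by rewrite mnmE ordS_max -!mul_mpolyC; ring.
by rewrite scale1r mnmE; ring.
Qed.

Lemma cyc_chain (i q : 'I_n.+1) u : (i <= q)%N ->
  (forall j : 'I_n.+1, (i <= j < q)%N -> u j = e j) ->
  'X_i * 'X_[u] - 'X_q * 'X_[u] \in I.
Proof.
have [k] := ubnP (q - i)%N; elim: k i => // k IH i ik iq full.
have [->|iq'] := eqVneq i q; first by rewrite subrr rpred0.
have lt : (i < q)%N by rewrite ltn_neqAle iq' iq.
have i_n : (i < n)%N by have := ltn_ord q; lia.
have Si := ordS_val i_n.
rewrite -[_ - _](subrKA ('X_(ordS i) * 'X_[u])); apply: rpredD.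
  have := @cyc_step i u; case: eqP => [im|_]; first by rewrite im ltnn in i_n.
  by rewrite scale1r; apply; apply: full; lia.
by apply: IH; rewrite ?Si; [lia | lia |] => j jq; apply: full; lia.
Qed.

Lemma cyc_around (i : 'I_n.+1) u : (forall j : 'I_n.+1, (i <= j)%N -> u j = e j) ->
  'X_i * 'X_[u] - a *: ('X_ord0 * 'X_[u]) \in I.
Proof.
move=> full; rewrite -[_ - _](subrKA ('X_ord_max * 'X_[u])); apply: rpredD.
  by apply: cyc_chain => [|j /andP[ij _]]; [rewrite -ltnS | exact: full].
by have := @cyc_step ord_max u; rewrite eqxx ordS_max; apply; apply: full; rewrite -ltnS.
Qed.

(** The three outcomes: the unit settles at or after i, it passes the end once with a factor [a] and
    settles before i, or all positions are full and the product vanishes. *)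
Lemma straighten (i : 'I_n.+1) u : (u <= e)%MM ->
  [\/ exists2 q, settles e u i q & 'X_i * 'X_[u] - 'X_[u + U_(q)] \in I,
      (forall j : 'I_n.+1, (i <= j)%N -> u j = e j) /\
      (exists2 q, settles_around e u i q & 'X_i * 'X_[u] - a *: 'X_[u + U_(q)] \in I) |
      (forall j : 'I_n.+1, (i <= j)%N -> u j = e j) /\ 'X_i * 'X_[u] \in I].
Proof.
move=> /mnm_lepP ue; pose free (P : pred 'I_n.+1) := [exists q, P q && (u q < e q)%N].
have first_free (P : pred 'I_n.+1) : free P -> exists q, [/\ P q, (u q < e q)%N &
    forall j, P j -> (j < q)%N -> u j = e j].
  case/existsP=> q0 q0P.
  case: (@arg_minnP _ q0 (fun q => P q && (u q < e q)%N) (fun q => q : nat) q0P).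
  move=> q /andP[Pq uq] qmin; exists q; split=> // j Pj jq.
  have := ue j; rewrite leq_eqVlt => /predU1P[//|uj].
  by have := qmin j; rewrite Pj uj => /(_ isT); lia.
have no_free (P : pred 'I_n.+1) : ~~ free P -> forall j, P j -> u j = e j.
  move=> /existsPn h j Pj; have := h j; rewrite Pj /= -leqNgt => uj.
  by apply/eqP; rewrite eqn_leq ue.
have [/first_free[q [iq uq full]]|/no_free iF] := boolP (free (fun q => i <= q)%N).
  constructor 1; exists q; first by split=> // j /andP[ij jq]; apply: full.
  rewrite addmC mpolyXD; apply: cyc_chain => // j /andP[ij jq]; exact: full.
have Xi := cyc_around iF.
have [/first_free[q [_ uq full]]|/no_free F] := boolP (free predT).
  have qi : (q < i)%N by rewrite ltnNge; apply/negP => /iF E; rewrite E ltnn in uq.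
  constructor 2; split=> //; exists q; first by split=> // j; apply: full.
  rewrite -[_ - _](subrKA (a *: ('X_ord0 * 'X_[u]))); apply: rpredD => //.
  rewrite -scalerBr idealZ // addmC mpolyXD; apply: cyc_chain => // j /andP[_ jq].
  exact: full.
(* When all positions are full, a full turn gives ['X_ord0 * 'X_[u]] congruent to [a] times itself,
   hence to 0 as [a] is not 1. *)
constructor 3; split=> //; have X0 := @cyc_around ord0 u (fun j _ => F j isT).
have {}X0 : 'X_ord0 * 'X_[u] \in I.
  have a1 : 1 - a != 0 by rewrite subr_eq0 eq_sym.
  by rewrite -[_ * _](scalerK a1) idealZ // scalerBl scale1r.
by rewrite -[_ * _](subrK (a *: ('X_ord0 * 'X_[u]))); apply: rpredD; rewrite ?idealZ.
Qed.

Lemma settles_uniq u i q1 q2 : settles e u i q1 -> settles e u i q2 -> q1 = q2.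
Proof.
move=> [i1 u1 f1] [i2 u2 f2]; apply: val_inj; apply/eqP; rewrite /= eqn_leq.
apply/andP; split; rewrite leqNgt; apply/negP => lt.
  by have := f1 q2; rewrite i2 lt => /(_ isT) E; rewrite E ltnn in u2.
by have := f2 q1; rewrite i1 lt => /(_ isT) E; rewrite E ltnn in u1.
Qed.

Local Notation mon := (@box_mon n e).
Local Notation ht := (height e).

(** The last clause identifies the coefficients that survive at t = 0, those with no gain in height
    beyond [var_height l], with the summands of [limit_mx]. *)
Lemma cyc_mul_coeffs (i : 'I_(box_size e)) (l : 'I_n.+1) :
  exists C : 'I_(box_size e) -> K,
  [/\ 'X_l * 'X_[mon i] - \sum_k C k *: 'X_[mon k] \in I,
      forall k, C k != 0 ->
        (ht (mon i) + var_height l <= ht (mon k))%N /\ mdeg (mon k) = (mdeg (mon i)).+1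
    & forall k, (if ht (mon k) == (ht (mon i) + var_height l)%N then C k else 0) =
        ((brk e (mon k) == brk e (mon i)) &&
         (code e (mon k) == (code e (mon i) + U_(l))%MM))%:R].
Proof.
set u := mon i; have ue : (u <= e)%MM := box_mon_le i.
have matchP k : brk e (mon k) == brk e u -> code e (mon k) == (code e u + U_(l))%MM ->
    exists2 q, settles e u l q & mon k = (u + U_(q))%MM.
  move=> /eqP kb /eqP kc; have [|q [qs qb qc]] := @settles_code _ e u l ue.
    by rewrite -kb -kc code_le // box_mon_le.
  exists q => //; have [lq uq _] := qs; apply: (@code_inj _ e); rewrite ?box_mon_le ?kb ?qb ?kc ?qc //.
  apply/mnm_lepP => t; rewrite mnmDE mnm1E.
  by have [<-|_] := eqVneq; [rewrite addn1 | rewrite addn0; apply/mnm_lepP].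
have indexP q : (u q < e q)%N -> exists k, mon k = (u + U_(q))%MM.
  move=> uq; apply: box_mon_surj; apply/mnm_lepP => t; rewrite mnmDE mnm1E.
  by have [<-|_] := eqVneq; [rewrite addn1 | rewrite addn0; apply/mnm_lepP].
have sum1 c k0 : \sum_k (if k == k0 then c else 0) *: 'X_[mon k] = c *: 'X_[mon k0] :> R.
  rewrite (bigD1 k0) //= eqxx big1 ?addr0 // => k /negbTE ->.
  by rewrite scale0r.
have deg1 q : mdeg (u + U_(q))%MM = (mdeg u).+1 by rewrite mdegD mdeg1 addn1.
have nomatch k : (forall j : 'I_n.+1, (l <= j)%N -> u j = e j) ->
    (brk e (mon k) == brk e u) && (code e (mon k) == (code e u + U_(l))%MM) = false.
  move=> full; apply/negP => /andP[kb kc]; have [q [lq uq _] _] := matchP k kb kc.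
  by rewrite full // ltnn in uq.
have [[q qs qI]|[full [q qs qI]]|[full uI]] := straighten l ue.
- have [_ uq _] := qs; have [k0 k0E] := indexP q uq.
  exists (fun k => if k == k0 then 1 else 0); rewrite sum1 scale1r k0E; split=> // k.
    have [->|_] := eqVneq k k0; last by rewrite eqxx.
    by rewrite k0E deg1 (height_settles ue qs).
  have [->|kk0] := eqVneq k k0.
    by rewrite k0E eq_sym (height_settles ue qs); case: (_ && _).
  rewrite if_same; case: (boolP (_ && _)) => // /andP[kb kc].
  have [q' qs' kE] := matchP k kb kc.
  by case/eqP: kk0; apply: box_mon_inj; rewrite k0E kE (settles_uniq qs' qs).
- have [_ uq _] := qs; have [k0 k0E] := indexP q uq.
  have h := height_settles_around ue qs.
  exists (fun k => if k == k0 then a else 0); rewrite sum1 k0E; split=> // k.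
    have [->|_] := eqVneq k k0; last by rewrite eqxx.
    by rewrite k0E deg1 ltnW.
  rewrite nomatch //; have [->|_] := eqVneq k k0; last by rewrite if_same.
  by rewrite k0E gtn_eqF.
- exists (fun=> 0); split=> [|k|k]; rewrite ?eqxx ?nomatch ?if_same //.
  by rewrite big1 ?subr0 // => k _; rewrite scale0r.
Qed.

End Straightening.

(** * From the deformed matrix to the quotient algebra *)

Section Lefschetz.
Variables (K : fieldType) (charK0 : [pchar K] =i pred0).
Variables (n : nat) (d : 'I_n.+1 -> nat) (a : K).
Hypothesis a_neq1 : a != 1.
Local Notation R := {mpoly K[n.+1]}.
Local Notation I := (cyc_ideal d a).
Local Notation A := {ideal_quot I}.
Local Notation e := (cyc_exp d).
Local Notation mon := (@box_mon n e).
Local Notation ht := (height e).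
Local Notation V := 'rV[K]_(box_size e).
Local Notation in_deg := (in_degree (fun i => mdeg (mon i))).

(* In the basis t ^- ht (mon i) *: 'X_[mon i] of the quotient, L.[t] is the matrix
   of the multiplication by \sum_l t ^- var_height l *: 'X_l. *)
Lemma deformation_mx : exists (C : 'I_(box_size e) -> 'I_n.+1 -> 'I_(box_size e) -> K)
  (L : 'M[{poly K}]_(box_size e)),
  [/\ forall i l, 'X_l * 'X_[mon i] - \sum_k C i l k *: 'X_[mon k] \in I,
      forall i l k, C i l k != 0 -> (ht (mon i) + var_height l <= ht (mon k))%N,
      forall i k, L i k = \sum_l (C i l k)%:P *
        'X^(ht (mon k) - (ht (mon i) + var_height l)),
      graded_mx (fun i => mdeg (mon i)) 1 L &
      map_mx (horner_eval 0) L = limit_mx e K].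
Proof.
have CE (i : 'I_(box_size e)) := fin_all_exists (cyc_mul_coeffs a_neq1 i).
have [C {}CE] := fin_all_exists CE.
pose L : 'M[{poly K}]_(box_size e) := \matrix_(i, k) \sum_l (C i l k)%:P *
  'X^(ht (mon k) - (ht (mon i) + var_height l)).
exists C, L; split=> [i l|i l k Ck|i k|i k ik|].
- by case: (CE i l).
- by case: (CE i l) => _ /(_ k Ck)[].
- by rewrite mxE.
- rewrite mxE big1 // => l _; have [->|Ck] := eqVneq (C i l k) 0; first by rewrite mul0r.
  by case: (CE i l) => _ /(_ k Ck)[_ E] _; rewrite E addn1 eqxx in ik.
apply/matrixP => i k; rewrite !mxE /horner_eval horner_sum; apply: eq_bigr => l _.
case: (CE i l) => _ /(_ k) h <-; rewrite hornerM hornerC hornerXn.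
have [->|Ck] := eqVneq (C i l k) 0; first by rewrite mul0r if_same.
have [le _] := h Ck; rewrite expr0n subn_eq0 eqn_leq le andbT.
by case: ifP; rewrite ?mulr1 ?mulr0.
Qed.

Definition scaled_sum (t : K) (v : V) : R :=
  \sum_i (v 0 i * t ^- ht (mon i)) *: 'X_[mon i].

Definition scaled_form (t : K) : R := \sum_l t ^- var_height l *: 'X_l.

Section Fixed.
Variables (t : K) (t0 : t != 0).
Local Notation iota := (scaled_sum t).
Local Notation ell := (scaled_form t).

Lemma scaled_sumD u v : iota (u + v) = iota u + iota v.
Proof.
by rewrite -big_split; apply: eq_bigr => i _; rewrite mxE mulrDl scalerDl.
Qed.

Lemma scaled_sumZ c v : iota (c *: v) = c *: iota v.
Proof. by rewrite scaler_sumr; apply: eq_bigr => i _; rewrite mxE scalerA mulrA. Qed.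

Lemma scaled_sum0 : iota 0 = 0.
Proof. by rewrite /scaled_sum big1 // => i _; rewrite mxE mul0r scale0r. Qed.

Lemma scaled_sum_homog j v : in_deg j v -> iota v \is j.-homog.
Proof.
move=> vj; apply: rpred_sum => i _; have [ij|/vj ->] := eqVneq (mdeg (mon i)) j.
  by rewrite dhomogZ // dhomogX /= ij.
by rewrite mul0r scale0r dhomog0.
Qed.

Lemma scaled_form_homog s : ell ^+ s \is s.-homog.
Proof.
have h : ell \is 1.-homog.
  by apply: rpred_sum => l _; rewrite dhomogZ // dhomogX /= mdeg1.
by have := dhomogMn s h; rewrite mul1n.
Qed.

Lemma mcoeff_scaled_sum v i : (iota v)@_(mon i) = v 0 i * t ^- ht (mon i).
Proof.
rewrite raddf_sum (bigD1 i) //= mcoeffZ mcoeffX eqxx mulr1 big1 ?addr0 // => k ki.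
rewrite mcoeffZ mcoeffX; case: eqP => [/box_mon_inj ik|]; last by rewrite mulr0.
by rewrite ik eqxx in ki.
Qed.

Lemma scaled_sum_inj v : iota v \in I -> v = 0.
Proof.
move=> /mem_cyc_ideal vI; have : iota v = 0.
  apply: gen_ideal_box vI => // m; rewrite raddf_sum /= => h.
  have : [exists i, mon i == m].
    apply: contraNT h => /existsPn h; rewrite big1 // => i _.
    by rewrite mcoeffZ mcoeffX (negbTE (h i)) mulr0.
  by case/existsP => i /eqP <-; apply: box_mon_le.
move=> v0; apply/rowP => i; have := mcoeff_scaled_sum v i; rewrite v0 mcoeff0 mxE.
by move/esym/eqP; rewrite mulf_eq0 invr_eq0 expf_eq0 (negbTE t0) andbF orbF => /eqP.
Qed.

Definition spans j (p : R) := exists2 v, in_deg j v & p - iota v \in I.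

Lemma spansD j p q : spans j p -> spans j q -> spans j (p + q).
Proof.
move=> [u uj pu] [v vj qv]; exists (u + v).
  by move=> i ij; rewrite mxE uj // vj // addr0.
by rewrite scaled_sumD opprD addrACA rpredD.
Qed.

Lemma spansZ j c p : spans j p -> spans j (c *: p).
Proof.
move=> [u uj pu]; exists (c *: u); first by move=> i ij; rewrite mxE uj // mulr0.
by rewrite scaled_sumZ -scalerBr idealZ.
Qed.

Lemma spans0 j : spans j 0.
Proof. by exists 0; [move=> i _; rewrite mxE | rewrite scaled_sum0 subrr rpred0]. Qed.

Lemma spans_sum j (T : Type) (r : seq T) (P : pred T) (F : T -> R) :
  (forall i, P i -> spans j (F i)) -> spans j (\sum_(i <- r | P i) F i).
Proof. by move=> PF; elim/big_ind: _ => //; [exact: spans0 | exact: spansD]. Qed.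

Lemma spans_congr j p q : p - q \in I -> spans j q -> spans j p.
Proof.
by move=> pq [v vj qv]; exists v => //; rewrite -[_ - _](subrKA q) rpredD.
Qed.

Lemma spans_box i : spans (mdeg (mon i)) 'X_[mon i].
Proof.
exists (t ^+ ht (mon i) *: delta_mx 0 i).
  move=> k ki; rewrite !mxE eqxx; case: eqP => [ik|]; last by rewrite mulr0.
  by rewrite ik eqxx in ki.
rewrite /scaled_sum (bigD1 i) //= !mxE !eqxx mulr1 divff ?expf_neq0 // scale1r.
rewrite big1 ?addr0 ?subrr ?rpred0 // => k /negbTE ki.
by rewrite !mxE eqxx ki mulr0 mul0r scale0r.
Qed.

Lemma spansXU j l p : spans j p -> spans j.+1 ('X_l * p).
Proof.
move=> [v vj pv]; apply: (spans_congr (q := 'X_l * iota v)).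
  by rewrite -mulrBr idealMr.
rewrite mulr_sumr; apply: spans_sum => i _; rewrite -scalerAr.
have [<-|/vj ->] := eqVneq (mdeg (mon i)) j; last by rewrite mul0r scale0r; apply: spans0.
apply: spansZ; have [C [CI Cd _]] := cyc_mul_coeffs a_neq1 i l.
apply: spans_congr CI _; apply: spans_sum => k _.
have [->|/Cd[_ <-]] := eqVneq (C k) 0; first by rewrite scale0r; apply: spans0.
exact/spansZ/spans_box.
Qed.

(** A monomial is built up from 1, which lies in the box, one variable at a time. *)
Lemma spans_homog j p : p \is j.-homog -> spans j p.
Proof.
move=> pj; rewrite [p]mpolyE big_seq; apply: spans_sum => m mp; apply: spansZ.
rewrite -(dhomog_mf pj mp) /= => {p pj mp}.
have [k] := ubnP (mdeg m); elim: k m => // k IH m mk.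
have [m0|/existsPn m0] := boolP [exists l, 0 < m l]%N.
  case/existsP: m0 => l ml.
  have lm : (U_(l) <= m)%MM by rewrite lep1mP -lt0n.
  rewrite -(submK lm) addmC mpolyXD mdegD mdeg1 add1n; apply/spansXU/IH.
  by move: mk; rewrite -{1}(submK lm) mdegD mdeg1 addn1.
have [|i <-] := @box_mon_surj _ e m; last exact: spans_box.
by apply/mnm_lepP => l; have := m0 l; rewrite -leqNgt leqn0 => /eqP ->.
Qed.

Lemma spans_all p : exists v, p - iota v \in I.
Proof.
rewrite [p]mpolyE; elim/big_ind: _ => [|q1 q2 [u Iu] [v Iv]|m _].
- by exists 0; rewrite scaled_sum0 subrr rpred0.
- by exists (u + v); rewrite scaled_sumD opprD addrACA rpredD.
have : spans (mdeg m) 'X_[m] by apply: spans_homog; rewrite dhomogX.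
by move=> /(spansZ p@_m)[v _ Iv]; exists v.
Qed.

Variables (C : 'I_(box_size e) -> 'I_n.+1 -> 'I_(box_size e) -> K)
  (L : 'M[{poly K}]_(box_size e)).
Hypotheses
  (CI : forall i l, 'X_l * 'X_[mon i] - \sum_k C i l k *: 'X_[mon k] \in I)
  (Cht : forall i l k, C i l k != 0 -> (ht (mon i) + var_height l <= ht (mon k))%N)
  (LE : forall i k, L i k =
     \sum_l (C i l k)%:P * 'X^(ht (mon k) - (ht (mon i) + var_height l))).
Local Notation Lt := (map_mx (horner_eval t) L).

Lemma scaled_form_mul v : ell * iota v - iota (v *m Lt) \in I.
Proof.
have -> : iota (v *m Lt) = \sum_i \sum_l
    (v 0 i * t ^- (ht (mon i)) * t ^- var_height l) *: \sum_k C i l k *: 'X_[mon k].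
  rewrite /scaled_sum; under eq_bigr do rewrite mxE mulr_suml scaler_suml.
  rewrite exchange_big; apply: eq_bigr => i _ /=.
  under [RHS]eq_bigr do rewrite scaler_sumr.
  rewrite [RHS]exchange_big; apply: eq_bigr => k _ /=.
  rewrite mxE LE /horner_eval horner_sum mulr_sumr mulr_suml scaler_suml.
  apply: eq_bigr => l _; rewrite scalerA hornerM hornerC hornerXn; congr (_ *: _).
  (* The subtraction in the exponent is exact whenever the coefficient is nonzero. *)
  have [->|/Cht le] := eqVneq (C i l k) 0; first by rewrite !(mul0r, mulr0).
  have -> : t ^+ ht (mon k) =
      t ^+ (ht (mon k) - (ht (mon i) + var_height l)) * (t ^+ ht (mon i) * t ^+ var_height l).
    by rewrite -!exprD subnK.
  have tn k' : t ^+ k' != 0 by rewrite expf_neq0.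
  move: (tn (ht (mon k) - (ht (mon i) + var_height l))%N) (tn (ht (mon i))) (tn (var_height l)).
  by move: (t ^+ _) (t ^+ _) (t ^+ _) => x y z x0 y0 z0; field; rewrite x0 y0 z0.
rewrite mulr_sumr -sumrB; apply: rpred_sum => i _.
rewrite mulr_suml -sumrB; apply: rpred_sum => l _.
rewrite -scalerAl -scalerAr scalerA [_ * (v 0 i * _)]mulrC -scalerBr.
exact: idealZ.
Qed.

Lemma scaled_form_mulX v s : ell ^+ s * iota v - iota (v *m Lt ^+ s) \in I.
Proof.
elim: s => [|s IH]; first by rewrite !expr0 mul1r mulmx1 subrr rpred0.
rewrite [in X in _ - X]exprSr -mulmxE mulmxA exprS -mulrA.
rewrite -[_ - _](subrKA (ell * iota (v *m Lt ^+ s))) rpredD ?scaled_form_mul //.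
by rewrite -mulrBr idealMr.
Qed.

End Fixed.

Lemma cyc_quot_eq (p q : R) : (\pi_A p = \pi_A q) <-> p - q \in I.
Proof. by rewrite Quotient.idealrBE; split=> [->|/eqP]. Qed.

(** With c = [mdeg e], the bijections from degree j to degree c - j suffice: every power of the
    linear form is an initial or a final factor of one of them, or has target zero. *)
Lemma cyc_strong_lefschetz : strong_lefschetz I.
Proof.
have [C [L [CI Cht LE gL L0]]] := deformation_mx.
have [flip flipK deg_flip] := box_flip e.
have inj0 j (v : V) : (2 * j <= mdeg e)%N -> in_deg j v ->
    v *m map_mx (horner_eval 0) L ^+ (mdeg e - 2 * j)%N = 0 -> v = 0.
  by rewrite L0; apply: limit_mx_injective.
have [t t0 bij] := exists_bijective_horner flipK deg_flip charK0 gL inj0.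
pose l := scaled_form t.
have mulX := scaled_form_mulX t0 CI Cht LE.
have gLt s : graded_mx (fun i => mdeg (mon i)) s (map_mx (horner_eval t) L ^+ s).
  by apply: graded_mxX => i k ik; rewrite mxE gL // /horner_eval horner0.
have piX s p : (\pi_A l ^+ s * \pi_A p = \pi_A (l ^+ s * p)).
  by rewrite rmorphM rmorphXn.
exists (\pi_A l); first by exists l => //; have := scaled_form_homog t 1; rewrite expr1.
move=> k s sk; have [le|gt] := leqP (2 * k) (mdeg e + s).
  (* Here s is at most c - 2(k - s), so the power s is an initial factor of the bijection starting
     in degree k - s. *)
  left=> _ _ [p pk ->] [q qk ->]; rewrite !piX => /cyc_quot_eq; rewrite -mulrBr => pqI.
  apply/cyc_quot_eq; have [v vk pv] := spans_homog t0 (rpredB pk qk).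
  suff v0 : v = 0 by rewrite v0 scaled_sum0 subr0 in pv.
  have le2 : (2 * (k - s) <= mdeg e)%N by lia.
  have [inj _] := bij _ le2; apply: inj => //; apply: (scaled_sum_inj t0).
  set r := (mdeg e - 2 * (k - s))%N.
  have lv : l ^+ r * scaled_sum t v \in I.
    have -> : r = ((r - s) + s)%N by rewrite /r; lia.
    rewrite exprD -mulrA idealMr // -[scaled_sum t v](subKr (p - q)) mulrBr.
    by rewrite rpredB // idealMr.
  by rewrite -[scaled_sum _ _](subKr (l ^+ r * scaled_sum t v)) rpredB // mulX.
(* Here s is below 2k - c, so for k at most c the power s is a final factor of the bijection from
   degree c - k to degree k. *)
right=> _ [p pk ->]; have [w wk pw] := spans_homog t0 pk.
(* Above the socle degree [mdeg e] there are no basis monomials, and the target is zero. *)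
have [kc|ck] := leqP k (mdeg e); last first.
  have w0 : w = 0.
    apply/rowP => i; rewrite [RHS]mxE wk //; have := deg_flip i.
    by apply/contra_eqN => /eqP ->; lia.
  exists (\pi_A 0); first by exists 0 => //; apply: dhomog0.
  rewrite piX mulr0; apply/esym/cyc_quot_eq.
  by rewrite w0 scaled_sum0 in pw.
have le2 : (2 * (mdeg e - k) <= mdeg e)%N by lia.
have [_ /(_ w)] := bij _ le2; rewrite subKn // => /(_ wk)[v vk vw].
set r := (mdeg e - 2 * (mdeg e - k))%N in vw.
pose y := v *m map_mx (horner_eval t) L ^+ (r - s)%N.
have yk : in_deg (k - s)%N y.
  move=> i ik; rewrite mxE big1 // => j _.
  have [jk|/vk ->] := eqVneq (mdeg (mon j)) (mdeg e - k)%N; last by rewrite mul0r.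
  rewrite (gLt (r - s)%N j i) ?mulr0 // jk; apply: contraNneq ik => ->.
  by rewrite /r; apply/eqP; lia.
exists (\pi_A (scaled_sum t y)).
  by exists (scaled_sum t y) => //; apply: scaled_sum_homog.
rewrite piX; apply/cyc_quot_eq.
have {}pw : p - scaled_sum t (y *m map_mx (horner_eval t) L ^+ s) \in I.
  suff -> : y *m map_mx (horner_eval t) L ^+ s = w by [].
  rewrite -vw /y -mulmxA mulmxE -exprD; congr (_ *m _ ^+ _).
  by rewrite /r; lia.
rewrite -[_ - _](subrKA (scaled_sum t (y *m map_mx (horner_eval t) L ^+ s))).
by rewrite rpredD ?mulX // -opprB rpredN.
Qed.

(** Ideals of the quotient are subspaces, so a chain of them pulls back along the spanning map
    [scaled_sum 1] to a chain of subspaces of a finite-dimensional space. *)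
Lemma cyc_artinian : artinian A.
Proof.
move=> J Jid Jdec; pose W i (v : V) := J i (\pi_A (scaled_sum 1 v)).
have [N NW] : exists N, forall i, (N <= i)%N -> forall v, W N v -> W i v.
  apply: subspace_dcc => [i|i u v|i c v|i v]; rewrite /W; have [J0 JD JM] := Jid i.
  - by rewrite scaled_sum0 rmorph0.
  - by rewrite scaled_sumD rmorphD; apply: JD.
  - by rewrite scaled_sumZ -mul_mpolyC rmorphM; apply: JM.
  - exact: Jdec.
exists N => i Ni x; rewrite -[x]reprK.
have [v /cyc_quot_eq ->] := spans_all (oner_neq0 K) (repr x).
exact: NW.
Qed.

End Lefschetz.

Theorem theorem1p2 (K : fieldType) (charK0 : [pchar K] =i pred0)
    (n : nat) (d : 'I_n.+1 -> nat) (d_gt0 : forall i, (0 < d i)%N)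
    (a : K) (a_neq1 : a != 1) :
  [/\ artinian {ideal_quot (cyc_ideal d a)},
      complete_intersection (cyc_ideal d a)
    & strong_lefschetz (cyc_ideal d a)].
Proof.
split; first exact: cyc_artinian.
  exact: cyc_complete_intersection.
exact: cyc_strong_lefschetz.
Qed.
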